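(* Let $d\ge 1$ and let $P \subset \mathbb{R}^d$ be a $d$-dimensional polytope. Suppose $P$ has a triangulation $P = \bigsqcup_{i=1}^{\ell} P_i$ in which every $P_i$ is a lattice-face $d$-simplex (vertices of the $P_i$ that are not vertices of $P$ are allowed). Then $$\Omega(P) = \bigoplus_{i=1}^{\ell} \Omega(P_i).$$ Thus $$|\mathcal{L}(\Omega(P))| = \mathrm{Vol}_d(P).$$ Furthermore, the Ehrhart polynomial of $P$ is given, for every positive integer $m$, by $$i(P,m) = \mathrm{Vol}_d(mP) + i(\pi(P),m) = \sum_{k=0}^d \mathrm{Vol}_k\bigl(\pi^{(d-k)}(P)\bigr)\, m^k .$$
   Context: A polytope is the convex hull of a finite set of points; all polytopes are full-dimensional in their ambient space. A $d$-simplex is the convex hull of $d+1$ affinely independent points in $\mathbb{R}^d$. $\mathrm{conv}$ and $\mathrm{aff}$ denote convex hull and affine hull. $P=\bigsqcup_{i=1}^{\ell} P_i$ means $P=\bigcup_i P_i$ and for $i\ne j$ the intersection $P_i\cap P_j$ is contained in the boundaries of $P_i$ and $P_j$. For $0\le k\le d$, $\pi^{(k)}:\mathbb{R}^d \to \mathbb{R}^{d-k}$ is the map that forgets the last $k$ coordinates, and $\pi = \pi^{(1)}$. For a set $S \subset \mathbb{R}^d$, $\mathcal{L}(S) = S \cap \mathbb{Z}^d$. For a positive integer $m$, $mP = \{mx : x \in P\}$ and $i(P,m) = |\mathcal{L}(mP)|$ (for a polytope in $\mathbb{R}^0=\mathbb{Z}^0$, a single point, this is $1$). $\mathrm{Vol}_k$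 is the volume in $\mathbb{R}^k$ normalized with respect to $\mathbb{Z}^k$, i.e. Lebesgue measure on $\mathbb{R}^k$, with $\mathrm{Vol}_0$ of a point equal to $1$. For $y\in\mathbb{R}^{d-1}$ and a polytope $P\subset\mathbb{R}^d$, let $\rho(y,P)=\pi^{-1}(y)\cap P$ and, if $y\in\pi(P)$, let $n(y,P)$ be the point of $\rho(y,P)$ with smallest last coordinate. The negative boundary of $P$ is $NB(P)=\{n(y,P): y\in\pi(P)\}$, and the nonnegative part of $P$ is $\Omega(P)=P\setminus NB(P)$. Sets are regarded as multisets (each element with an integer multiplicity, equal to $1$ for the elements of an ordinary set and $0$ for non-elements), and $\oplus$ is addition of multisets, i.e. pointwise addition of multiplicities. So $\Omega(P)=\bigoplus_i\Omega(P_i)$ says that the indicator function of $\Omega(P)$ is the sum of the indicator functions of the $\Omega(P_i)$. Lattice-face polytopes are defined recursively. A $1$-dimensional polytope (in $\mathbb{R}^1$) is a lattice-face polytope if it is integral, i.e. its vertices are integers. For $d \ge 2$, a $d$-dimensional polytope $P\subset\mathbb{R}^d$ with vertex set $V$ is a lattice-face polytope if for every subset $U \subset V$ spanning a $(d-1)$-dimensional affine space: (a) $\pi(\mathrm{conv}(U))$ is a lattice-face polytope (of dimension $d-1$ in $\mathbb{R}^{d-1}$), and (b) $\pi(\mathcal{L}(\mathrm{aff}(U))) = \mathbb{Z}^{d-1}$. A lattice-face $d$-simplex is a $d$-simplex that is a lattice-face polytope. *)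

(* Defs.v *)
From HB Require Import structures.
From mathcomp Require Import all_boot all_order all_algebra.
From mathcomp Require Import all_classical all_reals all_analysis.

Set Implicit Arguments.
Unset Strict Implicit.
Unset Printing Implicit Defensive.

Import Order.TTheory GRing.Theory Num.Theory.
Import numFieldNormedType.Exports.

Local Open Scope classical_set_scope.
Local Open Scope ring_scope.

Section Polytopes.
Context {R : realType}.

Definition conv d (A : set 'rV[R]_d) : set 'rV[R]_d :=
  [set x | exists m (w : 'I_m -> R) (p : 'I_m -> 'rV[R]_d),
    [/\ forall i, 0 <= w i, \sum_i w i = 1,
        forall i, A (p i) & x = \sum_i w i *: p i]].

Definition aff d (A : set 'rV[R]_d) : set 'rV[R]_d :=
  [set x | exists m (w : 'I_m -> R) (p : 'I_m -> 'rV[R]_d),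
    [/\ \sum_i w i = 1, forall i, A (p i) & x = \sum_i w i *: p i]].

Definition affine_subspace d (k : nat) (A : set 'rV[R]_d) : Prop :=
  exists (p : 'rV[R]_d) (W : {vspace 'rV[R]_d}),
    \dim W = k /\ A = [set p + w | w in [set` W]].

Definition polytope d (P : set 'rV[R]_d) : Prop :=
  (exists2 V : set 'rV[R]_d, finite_set V & P = conv V) /\
  affine_subspace d (aff P).

Definition vertices d (P : set 'rV[R]_d) : set 'rV[R]_d :=
  [set v | P v /\ forall x y t, P x -> P y -> 0 < t < 1 ->
    v = (1 - t) *: x + t *: y -> x = v /\ y = v].

Definition affinely_independent d m (p : 'I_m -> 'rV[R]_d) : Prop :=
  forall w : 'I_m -> R,
    \sum_i w i = 0 -> \sum_i w i *: p i = 0 -> forall i, w i = 0.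

Definition simplex d (P : set 'rV[R]_d) : Prop :=
  exists p : 'I_d.+1 -> 'rV[R]_d, affinely_independent p /\ P = conv (range p).

(* $\pi^{(d-k)} : \mathbb{R}^d \to \mathbb{R}^k$, which forgets the last [d - k]
   coordinates. *)
Definition proj_to k d (h : (k <= d)%N) (x : 'rV[R]_d) : 'rV[R]_k :=
  \row_(i < k) x 0 (widen_ord h i).

(* $\pi = \pi^{(1)}$ *)
Definition drop_last d (x : 'rV[R]_d.+1) : 'rV[R]_d := proj_to (leqnSn d) x.

Definition last_coord d (x : 'rV[R]_d.+1) : R := x 0 ord_max.

Definition Zpts d : set 'rV[R]_d := [set x | forall i, x 0 i \is a Num.int].

Definition Lpts d (S : set 'rV[R]_d) : set 'rV[R]_d := S `&` @Zpts d.

Definition dilate d (m : nat) (P : set 'rV[R]_d) : set 'rV[R]_d :=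
  [set m%:R *: x | x in P].

(* [counting] is the cardinality, with value +oo on infinite sets. *)
Definition ehrhart d (P : set 'rV[R]_d) (m : nat) : \bar R :=
  counting (Lpts (dilate m P)).

Definition boundary d (A : set 'rV[R]_d) : set 'rV[R]_d :=
  closure A `\` interior A.

(* $P = \bigsqcup_i P_i$ *)
Definition decomposition d l (P : set 'rV[R]_d) (T : 'I_l -> set 'rV[R]_d) :
    Prop :=
  P = \bigcup_i T i /\
  forall i j, i != j -> T i `&` T j `<=` boundary (T i) `&` boundary (T j).

Definition fiber d (y : 'rV[R]_d) (P : set 'rV[R]_d.+1) : set 'rV[R]_d.+1 :=
  (@drop_last d) @^-1` [set y] `&` P.

(* [x] is the point $n(y, P)$. *)
Definition is_lowest d (y : 'rV[R]_d) (P : set 'rV[R]_d.+1)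
    (x : 'rV[R]_d.+1) : Prop :=
  fiber y P x /\ forall z, fiber y P z -> last_coord x <= last_coord z.

Definition NB d (P : set 'rV[R]_d.+1) : set 'rV[R]_d.+1 :=
  [set x | exists2 y, ((@drop_last d) @` P) y & is_lowest y P x].

Definition Omega d (P : set 'rV[R]_d.+1) : set 'rV[R]_d.+1 := P `\` NB P.

(* The index is shifted: [lattice_face] on 'rV_d.+1 is the notion for polytopes
   of dimension d + 1, the base case being dimension 1. *)
Fixpoint lattice_face d : set 'rV[R]_d.+1 -> Prop :=
  match d with
  | 0 => fun P => polytope P /\ vertices P `<=` @Zpts 1
  | d'.+1 => fun P => polytope P /\
      forall U, U `<=` vertices P -> affine_subspace d'.+1 (aff U) ->
        lattice_face ((@drop_last d'.+1) @` conv U) /\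
        (@drop_last d'.+1) @` Lpts (aff U) = @Zpts d'.+1
  end.

Definition lattice_face_simplex d (P : set 'rV[R]_d.+1) : Prop :=
  simplex P /\ lattice_face P.

End Polytopes.

Section Volume.
Context {R : realType}.

Record measurable_space := MeasurableSpace {
  space_display : measure_display;
  space :> measurableType space_display }.

(* The measurable space (..((unit * R) * R) * ..) * R with k factors R, and on
   it the k-fold product of the Lebesgue measure of the line. *)
Fixpoint Rspace (k : nat) : measurable_space :=
  match k with
  | 0 => MeasurableSpace unit
  | k'.+1 => MeasurableSpace (Rspace k' * measurableTypeR R)%type
  end.

Fixpoint lebesgue_Rn (k : nat) : {measure set Rspace k -> \bar R} :=
  match k return {measure set Rspace k -> \bar R} with
  | 0 => (\d_tt : {measure set unit -> \bar R})
  | k'.+1 => ((lebesgue_Rn k' \x lebesgue_measure)%E :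
      {measure set (Rspace k' * measurableTypeR R)%type -> \bar R})
  end.

Fixpoint coords (k : nat) : 'rV[R]_k -> Rspace k :=
  match k with
  | 0 => fun=> tt
  | k'.+1 => fun x => (coords (drop_last x), last_coord x)
  end.

(* [coords] is a bijection, so this is Lebesgue measure on $\mathbb{R}^k$;
   for k = 0 it gives measure 1 to the point. *)
Definition Vol k (A : set 'rV[R]_k) : \bar R := lebesgue_Rn k (@coords k @` A).

End Volume.

(* Main.v *)
Require Import Defs.
From mathcomp Require Import all_boot all_order all_algebra.
From mathcomp Require Import all_classical all_reals all_analysis.
From mathcomp Require Import ring lra zify.

Set Implicit Arguments.
Unset Strict Implicit.
Unset Printing Implicit Defensive.
Import Order.TTheory GRing.Theory Num.Theory.
Import numFieldNormedType.Exports.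
Local Open Scope classical_set_scope.
Local Open Scope ring_scope.

(** A lattice-face simplex is rigid: the affine hull of any k + 1 of its vertices is the
    graph, over the first k coordinates, of an affine function with integer
    coefficients. This property, [lattice_position], is extracted from the recursive
    definition once ([lattice_face_position]); unlike that definition it visibly passes
    to dilations, to projected facets and to slices by hyperplanes on which the first
    coordinate is a given integer.

    Since no facet of such a simplex is vertical, a point belongs to its nonnegative part
    exactly when every sufficiently small lowering of the point lies in the interior
    ([Omega_simp]). The nonnegative part of a convex union of simplices has the same
    description ([Omega_dissection]), and a slightly lowered point lies on no facet
    hyperplane; the additivity of indicator functions follows ([below_indicator]).

    The number of lattice points in the nonnegative part of a simplex in lattice position
    of dimension d is homogeneous of degree d under dilation
    ([homogeneous_count_simplex]). Indeed a slice of the simplex at an integral first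
    coordinate t is an alternating sum of simplices, one for each vertex with first
    coordinate tau below t ([below_slice]). Each is a translated dilation, by the factor
    t - tau, of a simplex in lattice position of dimension d - 1 that depends only on the
    vertex. By induction the slices contain f(t) lattice points, where f is a
    combination of truncated powers of degree d - 1 with integer knots; it vanishes
    beyond the last knot, and this makes the lower moments of its coefficients vanish.
    The sum of f over the integers is then its leading term, which is homogeneous of
    degree d ([truncated_power_sum]).

    The volume is obtained from these counts. Cubes of side 1/m squeeze m^d Vol(P)
    between the numbers of lattice points in the nonnegative parts of (m - K) P and of
    (m + K) P, for a constant K; both are homogeneous of degree d, so Vol(P) is the
    number for P itself ([Vol_dissection]).

    Finally a lattice point of the projection of P lifts to a lattice point of the
    negative boundary, because the lowest point over it lies on a facet
    ([Lpts_projection]); hence i(P, m) = Vol(m P) + i(pi(P), m). To iterate, the projection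
    of P is dissected by the projections of those facets of the simplices whose
    hyperplanes support P from below ([dissection_project]). *)

(** * Barycentric coordinates *)

Section Bary.
Variable R : realType.

(** The rows are the homogeneous coordinates (1, a_i). *)
Definition hmx d (a : 'I_d.+1 -> 'rV[R]_d) : 'M[R]_d.+1 :=
  \matrix_(i, j) oapp (fun j' => a i 0 j') 1 (unlift ord0 j).

Definition vcons d (c : R) (x : 'rV[R]_d) : 'rV[R]_d.+1 :=
  \row_j oapp (fun j' => x 0 j') c (unlift ord0 j).

(** Coefficients of (c, x) on the rows (1, a_i): barycentric coordinates of the point
    x for c = 1, and of the vector x for c = 0, so that one linear function serves for
    both. *)
Definition bar d (a : 'I_d.+1 -> 'rV[R]_d) (c : R) (x : 'rV[R]_d) i : R :=
  (vcons c x *m invmx (hmx a)) 0 i.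

Lemma mulmx_hmx d (a : 'I_d.+1 -> 'rV[R]_d) (w : 'rV[R]_d.+1) :
  w *m hmx a = vcons (\sum_i w 0 i) (\sum_i w 0 i *: a i).
Proof.
apply/rowP => j; rewrite !mxE; case: unliftP => [j' ->|->] /=.
  rewrite summxE; apply: eq_bigr => i _; rewrite !mxE.
  by rewrite liftK.
by apply: eq_bigr => i _; rewrite !mxE unlift_none /= mulr1.
Qed.

Lemma vcons_inj d c c' (x x' : 'rV[R]_d) : vcons c x = vcons c' x' -> c = c' /\ x = x'.
Proof.
move=> /rowP E; split; first by have := E ord0; rewrite !mxE unlift_none.
by apply/rowP => j; have := E (lift ord0 j); rewrite !mxE liftK.
Qed.

Lemma hmx_unit d (a : 'I_d.+1 -> 'rV[R]_d) :
  affinely_independent a -> hmx a \in unitmx.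
Proof.
move=> aff_a; rewrite -row_free_unit -kermx_eq0; apply/rowV0P => w.
have h0 : vcons 0 0 = (0 : 'rV[R]_d.+1).
  by apply/rowP => j; rewrite !mxE; case: unliftP => [j' _|_] /=; rewrite ?mxE.
move=> /sub_kermxP; rewrite mulmx_hmx -[X in _ = X -> _]h0.
move=> /vcons_inj[w0 w1]; apply/rowP => i; rewrite mxE.
exact: (aff_a (fun i => w 0 i) w0 w1 i).
Qed.

Variables (d : nat) (a : 'I_d.+1 -> 'rV[R]_d).
Hypothesis aff_a : affinely_independent a.

Lemma barP c x : \sum_i bar a c x i = c /\ \sum_i bar a c x i *: a i = x.
Proof. by apply: vcons_inj; rewrite -mulmx_hmx mulmxKV ?hmx_unit. Qed.

Lemma bar_sum c x : \sum_i bar a c x i = c. Proof. exact: (barP c x).1. Qed.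
Lemma bar_comb c x : \sum_i bar a c x i *: a i = x.
Proof. exact: (barP c x).2. Qed.

Lemma bar_uniq (w : 'I_d.+1 -> R) i :
  bar a (\sum_i w i) (\sum_i w i *: a i) i = w i.
Proof.
set c := \sum_i w i; set x := \sum_i _.
apply/eqP; rewrite -subr_eq0; apply/eqP.
apply: (aff_a (w := fun i => bar a c x i - w i)).
  by rewrite sumrB bar_sum subrr.
under eq_bigr do rewrite scalerBl.
by rewrite sumrB bar_comb subrr.
Qed.

Lemma bar_eq (w : 'I_d.+1 -> R) c x :
  \sum_i w i = c -> \sum_i w i *: a i = x -> bar a c x =1 w.
Proof. by move=> <- <- i; exact: bar_uniq. Qed.

Lemma barD c c' x x' i :
  bar a (c + c') (x + x') i = bar a c x i + bar a c' x' i.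
Proof.
apply: bar_eq (fun i => _) _ _ _ _ i.
  by rewrite big_split /= !bar_sum.
under eq_bigr do rewrite scalerDl.
by rewrite big_split /= !bar_comb.
Qed.

Lemma barZ k c x i : bar a (k * c) (k *: x) i = k * bar a c x i.
Proof.
apply: bar_eq (fun i => _) _ _ _ _ i.
  by rewrite -mulr_sumr bar_sum.
under eq_bigr do rewrite -scalerA.
by rewrite -scaler_sumr bar_comb.
Qed.

End Bary.

(** * Simplices in lattice position *)

Section Position.
Variable R : realType.

(** The affine hull of k + 1 vertices is the graph, over the first k coordinates, of
    an affine function with integer coefficients. By substitution it suffices to
    express the coordinate of index k through the preceding ones. *)
Definition lattice_position d (a : 'I_d.+1 -> 'rV[R]_d) : Prop :=
  affinely_independent a /\
  forall (k : 'I_d) (S : {set 'I_d.+1}), (#|S| <= k.+1)%N ->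
    exists (c0 : R) (c : 'I_d -> R),
      [/\ c0 \is a Num.int, forall j, c j \is a Num.int &
        forall i, i \in S -> a i 0 k = c0 + \sum_(j < d | (j < k)%N) c j * a i 0 j].

(** A relation between the coordinates of some vertices is inherited by all
    combinations supported on them. *)
Lemma lattice_position_sum d (a : 'I_d.+1 -> 'rV[R]_d) (k : 'I_d)
    (w : 'I_d.+1 -> R) :
  lattice_position a -> (#|[set i | w i != 0%R]%SET| <= k.+1)%N ->
  exists (c0 : R) (c : 'I_d -> R),
      [/\ c0 \is a Num.int, forall j, c j \is a Num.int &
        (\sum_i w i *: a i) 0 k =
          c0 * \sum_i w i + \sum_(j < d | (j < k)%N) c j * (\sum_i w i *: a i) 0 j].
Proof.
move=> [_ latt] Sk; have [c0 [c [c0Z cZ ak]]] := latt _ _ Sk; exists c0, c; split => //.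
rewrite summxE mulr_sumr.
under [X in _ = _ + X]eq_bigr do rewrite summxE mulr_sumr.
rewrite exchange_big -big_split /=; apply: eq_bigr => i _; rewrite mxE.
have [->|wi0] := eqVneq (w i) 0.
  by rewrite mul0r mulr0 add0r big1 // => j _; rewrite mxE mul0r mulr0.
rewrite ak ?inE// mulrDr mulrC mulr_sumr; congr (_ + _).
by apply: eq_bigr => j _; rewrite mxE mulrCA.
Qed.

(** The remaining coordinates are functions of the first k, so k + 1 vertices are
    still affinely independent after projection to the first k coordinates. *)
Lemma lattice_position_indep d (a : 'I_d.+1 -> 'rV[R]_d) (k : nat)
    (w : 'I_d.+1 -> R) :
  lattice_position a -> (#|[set i | w i != 0%R]%SET| <= k.+1)%N ->
  \sum_i w i = 0 -> (forall j : 'I_d, (j < k)%N -> (\sum_i w i *: a i) 0 j = 0) ->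
  forall i, w i = 0.
Proof.
move=> latt suppw w0 wk; apply: latt.1 => //; apply/rowP => j; rewrite [RHS]mxE.
have [n] := ubnP (j : nat); elim: n j => // n IH j /ltnSE jn.
have [|kj] := ltnP j k; first exact: wk.
have [||c0 [c [_ _ ->]]] := @lattice_position_sum d a j w => //.
  exact: leq_trans suppw _.
rewrite w0 mulr0 add0r big1// => i ij; rewrite IH ?mulr0//.
exact: leq_trans ij jn.
Qed.

Lemma lattice_position_int d (a : 'I_d.+1 -> 'rV[R]_d) i (j : 'I_d) :
  lattice_position a -> a i 0 j \is a Num.int.
Proof.
move=> latt; have [n] := ubnP (j : nat); elim: n j => // n IH j /ltnSE jn.
have [|c0 [c [c0Z cZ ->]]] := latt.2 j [set i]%SET; first by rewrite cards1.
  rewrite rpredD// rpred_sum// => l lj; rewrite rpredM// IH//.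
  exact: leq_trans lj jn.
by rewrite inE.
Qed.

Lemma lattice_position_first_inj d (a : 'I_d.+2 -> 'rV[R]_d.+1) i j :
  lattice_position a -> a i 0 ord0 = a j 0 ord0 -> i = j.
Proof.
move=> latt aij; apply/eqP/negPn/negP => ij.
pose w k : R := (k == i)%:R - (k == j)%:R.
have sw (V : lmodType R) (f : 'I_d.+2 -> V) : \sum_k w k *: f k = f i - f j.
  under eq_bigr do rewrite scalerBl !scaler_nat.
  rewrite sumrB (bigD1 i)//= eqxx big1 ?addr0 => [|k /negPf ->//].
  by rewrite (bigD1 j)//= eqxx big1 ?addr0 => [//|k /negPf ->].
suff /(_ i) : forall k, w k = 0.
  by rewrite /w eqxx (negPf ij) subr0 => /eqP; rewrite oner_eq0.
apply: (lattice_position_indep (k := 1) latt).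
- apply: (@leq_trans #|[set i; j]%SET|); last by rewrite cards2; case: eqP.
  apply/subset_leq_card/fintype.subsetP => k; rewrite !inE /w.
  by case: (k == i); case: (k == j) => //; rewrite subrr eqxx.
- have := sw R^o (fun=> 1); rewrite subrr => sw1; rewrite -[RHS]sw1.
  by apply: eq_bigr => k _; rewrite /GRing.scale/= mulr1.
- by move=> l; rewrite ltnS leqn0 sw !mxE => /eqP l0;
    rewrite (_ : l = ord0) ?aij ?subrr//; apply/val_inj.
Qed.

Definition place d (p : 'rV[R]_d) (m : nat) (a : 'I_d.+1 -> 'rV[R]_d) i :=
  p + m%:R *: a i.

Lemma lattice_position_place d (p : 'rV[R]_d) m (a : 'I_d.+1 -> 'rV[R]_d) :
  (0 < m)%N -> (forall j, p 0 j \is a Num.int) -> lattice_position a ->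
  lattice_position (place p m a).
Proof.
move=> m0 pZ [aff_a latt]; split.
  move=> w w0; under eq_bigr do rewrite scalerDr scalerA mulrC -scalerA.
  rewrite big_split /= -scaler_suml w0 scale0r add0r -scaler_sumr => /eqP.
  rewrite scaler_eq0 pnatr_eq0 -leqn0 leqNgt m0/= => /eqP; exact: aff_a.
move=> k S Sk; have [c0 [c [c0Z cZ ak]]] := latt _ _ Sk.
exists (p 0 k - \sum_(j < d | (j < k)%N) c j * p 0 j + m%:R * c0), c; split=> //.
  rewrite rpredD ?rpredB ?rpred_sum//; last by rewrite rpredM ?natr_int.
  by move=> j _; rewrite rpredM.
move=> i iS; rewrite 2!mxE ak//.
under [X in _ = _ + X]eq_bigr do rewrite 2!mxE mulrDr mulrCA.
rewrite big_split /= -mulr_sumr mulrDr; ring.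
Qed.

Lemma card_lift_imset n (j : 'I_n.+1) (S : {set 'I_n}) :
  #|[set lift j k | k in S]%SET| = #|S|.
Proof. by rewrite card_imset//; exact: lift_inj. Qed.

Lemma sum_lift_extend (V : lmodType R) n (j : 'I_n.+1) (w : 'I_n -> R)
    (f : 'I_n.+1 -> V) :
  \sum_i oapp w 0 (unlift j i) *: f i = \sum_k w k *: f (lift j k).
Proof.
rewrite (bigD1_ord j)//= unlift_none/= scale0r add0r.
by apply: eq_bigr => k _; rewrite liftK.
Qed.

Lemma supp_lift_extend n (j : 'I_n.+1) (w : 'I_n -> R) :
  #|[set i | oapp w 0 (unlift j i) != 0%R]%SET| = #|[set k | w k != 0%R]%SET|.
Proof.
rewrite -(card_lift_imset j); congr #|pred_of_set _|.
apply/setP => i; rewrite inE; apply/idP/imsetP.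
  by case: unliftP => [k ->|->] /=; rewrite ?eqxx// => wk; exists k; rewrite ?inE.
by move=> [k]; rewrite inE => wk ->; rewrite liftK.
Qed.

Definition facet d (a : 'I_d.+2 -> 'rV[R]_d.+1) (j : 'I_d.+2) (k : 'I_d.+1) :=
  drop_last (a (lift j k)).

Lemma lattice_position_facet d (a : 'I_d.+2 -> 'rV[R]_d.+1) j :
  lattice_position a -> lattice_position (facet a j).
Proof.
move=> latt; split.
  move=> w w0 wa k.
  have := @lattice_position_indep _ _ d (fun i => oapp w 0 (unlift j i)) latt.
  move=> /(_ _ _ _ (lift j k)); rewrite liftK; apply.
  - by rewrite supp_lift_extend -[leqRHS]card_ord max_card.
  - by rewrite -[RHS]w0 (bigD1_ord j)//= unlift_none add0r; apply: eq_bigr => i _;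
      rewrite liftK.
  - move=> l ld; rewrite sum_lift_extend.
    have := congr1 (fun M : 'rV[R]_d => M 0 (Ordinal ld)) wa.
    rewrite !summxE mxE => wl; rewrite -[RHS]wl; apply: eq_bigr => i _; rewrite !mxE.
    by congr (_ * a _ _ _); apply/val_inj.
move=> k S Sk.
have [|c0 [c [c0Z cZ ak]]] := latt.2 (widen_ord (leqnSn d) k) [set lift j i | i in S]%SET.
  by rewrite card_lift_imset.
exists c0, (fun l => c (widen_ord (leqnSn d) l)); split => // i iS.
rewrite mxE ak; last by rewrite imset_f.
rewrite big_mkcond big_ord_recr/= ltnNge (ltnW (ltn_ord k))/= addr0.
by rewrite [in RHS]big_mkcond; congr (_ + _); apply: eq_bigr => l _; rewrite mxE.
Qed.

Definition tail d (x : 'rV[R]_d.+1) : 'rV[R]_d := \row_j x 0 (lift ord0 j).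

(** The lines from vertex i to the other vertices, translated so that vertex i is the
    origin, meet the hyperplane where the first coordinate is 1 in these points, of
    which only the other coordinates are kept. *)
Definition slope d (a : 'I_d.+3 -> 'rV[R]_d.+2) (i : 'I_d.+3) (k : 'I_d.+2) :=
  (a (lift i k) 0 ord0 - a i 0 ord0)^-1 *: tail (a (lift i k) - a i).

(** A relation for k + 1 slopes comes from the one for the k + 2 vertices involved:
    its constant cancels in the differences, and the coefficient of the first
    coordinate becomes the new constant. *)
Lemma lattice_position_slope d (a : 'I_d.+3 -> 'rV[R]_d.+2) i :
  lattice_position a -> lattice_position (slope a i).
Proof.
move=> latt.
have tau0 k : a (lift i k) 0 ord0 - a i 0 ord0 != 0.
  rewrite subr_eq0; apply/eqP => /(lattice_position_first_inj latt)/eqP.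
  by rewrite eq_sym (negPf (neq_lift _ _)).
split.
  move=> w w0 wa.
  pose v k := w k / (a (lift i k) 0 ord0 - a i 0 ord0).
  pose u l := oapp v 0 (unlift i l) - (l == i)%:R * \sum_k v k.
  have s1 : \sum_(l < d.+3) (l == i)%:R = 1 :> R.
    by rewrite (bigD1 i)//= eqxx big1 ?addr0 => [//|k /negPf ->].
  have u0 : \sum_l u l = 0.
    rewrite sumrB (bigD1_ord i)//= unlift_none/= add0r.
    under eq_bigr do rewrite liftK/=.
    by rewrite -mulr_suml s1 mul1r subrr.
  have ua : \sum_l u l *: a l = \sum_k v k *: (a (lift i k) - a i).
    under eq_bigr do rewrite scalerBl.
    rewrite sumrB sum_lift_extend; under [RHS]eq_bigr do rewrite scalerBr.
    rewrite sumrB -scaler_suml; congr (_ - _).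
    rewrite (bigD1 i)//= eqxx mul1r [X in _ + X]big1 ?addr0// => k /negPf ->.
    by rewrite mul0r scale0r.
  have uz : forall l, u l = 0.
    apply: latt.1 => //; rewrite ua; apply/rowP => l; rewrite summxE mxE.
    case: (unliftP ord0 l) => [l'|] ->.
      have := congr1 (fun M : 'rV[R]_d.+1 => M 0 l') wa.
      rewrite !summxE mxE => wl; rewrite -[RHS]wl; apply: eq_bigr => k _.
      by rewrite !mxE /v mulrA.
    by rewrite -[RHS]w0; apply: eq_bigr => k _; rewrite !mxE /v mulfVK.
  move=> k; have /eqP := uz (lift i k).
  rewrite /u liftK/= [lift i k == i]eq_sym (negPf (neq_lift _ _)) mul0r subr0 /v.
  by rewrite mulf_eq0 invr_eq0 (negPf (tau0 k)) orbF => /eqP.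
move=> k S Sk.
have [|c0 [c [c0Z cZ ak]]] := latt.2 (lift ord0 k) (i |: [set lift i l | l in S])%SET.
  by rewrite cardsU1 card_lift_imset /= -[leqRHS]add1n leq_add// leq_b1.
exists (c ord0), (fun l => c (lift ord0 l)); split => // l lS.
rewrite /slope 4!mxE !ak ?inE ?eqxx ?imset_f ?orbT//.
rewrite (_ : c0 + _ - _ = \sum_(j < d.+2 | (j < lift ord0 k)%N) c j * (a (lift i l) - a i) 0 j);
  last first.
  under [RHS]eq_bigr do rewrite 2!mxE mulrBr.
  by rewrite sumrB; ring.
rewrite big_mkcond big_ord_recl/= mulrDr 2!mxE mulrCA mulVf// mulr1; congr (_ + _).
rewrite -big_mkcond mulr_sumr; apply: eq_big => [j|j _]; first by rewrite ltnS.
by rewrite !mxE mulrCA.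
Qed.

(** No facet is parallel to the last coordinate axis: on its vertices the last
    coordinate is an affine function of the others, which do not change along the
    axis. *)
Lemma bar_last_neq0 d (a : 'I_d.+2 -> 'rV[R]_d.+1) i :
  lattice_position a -> bar a 0 (delta_mx 0 ord_max) i != 0.
Proof.
move=> latt; apply/eqP => bi0; set b := bar a 0 _ in bi0.
have [bs bc] := barP latt.1 0 (delta_mx 0 ord_max).
have [|c0 [c [_ _]]] := @lattice_position_sum _ a ord_max b latt.
  apply: (@leq_trans #|[set~ i]%SET|); last by rewrite cardsC1 card_ord.
  apply/subset_leq_card/fintype.subsetP => k; rewrite !inE.
  by apply: contraNneq => ->; rewrite bi0.
rewrite bs bc mulr0 add0r mxE !eqxx big1; first by move/eqP; rewrite oner_eq0.
by move=> j jd; rewrite mxE eqxx/= -val_eqE/= ltn_eqF// mulr0.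
Qed.

End Position.

(** * Lowering a point by an infinitesimal amount *)

Section Below.
Variable R : realType.

Lemma near0_pos (p q : R) : 0 < p -> \forall e \near 0^'+, 0 < p + e * q.
Proof.
move=> p0; have q0 : 0 < `|q| + 1 by rewrite ltr_pwDr.
near=> e.
have e0 : 0 < e by near: e; exact: nbhs_right_gt.
have : e < p / (`|q| + 1) by near: e; apply: nbhs_right_lt; rewrite divr_gt0.
rewrite ltr_pdivlMr// => epq.
have : - `|e * q| <= e * q by rewrite lerNl -normrN ler_norm.
rewrite normrM gtr0_norm// => h.
nra.
Unshelve. all: by end_near. Qed.

Lemma near0_sign (p q : R) : q != 0 ->
  (\forall e \near 0^'+, 0 < p - e * q) \/ (\forall e \near 0^'+, p - e * q < 0).
Proof.
move=> q0; have [p0|p0|->] := ltgtP p 0.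
- right; have pN : 0 < - p by rewrite oppr_gt0.
  by apply: filterS (near0_pos q pN) => e; rewrite -opprB opprB; lra.
- by left; apply: filterS (near0_pos (- q) p0) => e; rewrite mulrN.
- have e0 : \forall e \near 0^'+, 0 < e :> R by exact: nbhs_right_gt.
  have [q1|q1|q1] := ltgtP q 0; last by rewrite q1 eqxx in q0.
  + by left; apply: filterS e0 => e e0; nra.
  + by right; apply: filterS e0 => e e0; nra.
Qed.

Definition elast d : 'rV[R]_d.+1 := delta_mx 0 ord_max.

Definition simp d (a : 'I_d.+1 -> 'rV[R]_d) : set 'rV[R]_d :=
  [set x | forall i, 0 <= bar a 1 x i].

Definition osimp d (a : 'I_d.+1 -> 'rV[R]_d) : set 'rV[R]_d :=
  [set x | forall i, 0 < bar a 1 x i].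

Lemma osimp_simp d (a : 'I_d.+1 -> 'rV[R]_d) : osimp a `<=` simp a.
Proof. by move=> x ax i; exact: ltW. Qed.

(** For a closed convex set A this is the nonnegative part; lowering the point
    replaces the half-open boundary by an open condition. *)
Definition below d (A : set 'rV[R]_d.+1) : set 'rV[R]_d.+1 :=
  [set x | \forall e \near 0^'+, A (x - e *: elast d)].

Lemma bar_move d (a : 'I_d.+1 -> 'rV[R]_d) (e : R) x v i : affinely_independent a ->
  bar a 1 (x + e *: v) i = bar a 1 x i + e * bar a 0 v i.
Proof. by move=> aff_a; rewrite -barZ// -barD// mulr0 addr0. Qed.

Lemma bar_lower d (a : 'I_d.+2 -> 'rV[R]_d.+1) (e : R) x i :
  affinely_independent a ->
  bar a 1 (x - e *: elast d) i = bar a 1 x i - e * bar a 0 (elast d) i.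
Proof. by move=> aff_a; rewrite -scaleNr bar_move// mulNr. Qed.

Lemma near_bar_neq0 d (a : 'I_d.+2 -> 'rV[R]_d.+1) x : lattice_position a ->
  \forall e \near 0^'+, forall i, bar a 1 (x - e *: elast d) i != 0.
Proof.
move=> latt; apply: filter_forall => i.
case: (near0_sign (bar a 1 x i) (bar_last_neq0 i latt)); apply: filterS => e.
  by rewrite bar_lower; [rewrite lt0r => /andP[]|case: latt].
by rewrite bar_lower; [rewrite lt_neqAle => /andP[]|case: latt].
Qed.

(** The barycentric coordinates of the lowered point are affine functions of the
    amount with nonzero slopes, hence of constant nonzero sign near 0. *)
Lemma below_simp_dichotomy d (a : 'I_d.+2 -> 'rV[R]_d.+1) x : lattice_position a ->
  below (osimp a) x \/ below (~` simp a) x.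
Proof.
move=> latt; have [aff_a _] := latt.
have [allp|] := pselect (forall i,
    \forall e \near 0^'+, 0 < bar a 1 (x - e *: elast d) i).
  by left; exact: filter_forall.
move=> /existsNP[i ni]; right.
case: (near0_sign (bar a 1 x i) (bar_last_neq0 i latt)) => near_i.
  by exfalso; apply: ni; apply: filterS near_i => e; rewrite bar_lower.
apply: filterS near_i => e lti /(_ i).
by rewrite bar_lower//; rewrite leNgt lti.
Qed.

Lemma below_simpE d (a : 'I_d.+2 -> 'rV[R]_d.+1) : lattice_position a ->
  below (simp a) = below (osimp a).
Proof.
move=> latt; apply/seteqP; split => x; last first.
  by apply: filterS => e; exact: osimp_simp.
move=> bx; case: (below_simp_dichotomy x latt) => // nbx.
by have [e []] := filter_ex (@filterI _ _ _ _ _ bx nbx).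
Qed.

Lemma near_below d (a : 'I_d.+2 -> 'rV[R]_d.+1) x : lattice_position a ->
  \forall e \near 0^'+, osimp a (x - e *: elast d) <-> below (osimp a) x.
Proof.
move=> latt; case: (below_simp_dichotomy x latt) => bx; near=> e.
  by split=> // _; near: e.
split=> [ax|].
  have : ~ simp a (x - e *: elast d) by near: e.
  by move=> /(_ (osimp_simp ax)).
by move=> bx'; have [e' [/osimp_simp]] := filter_ex (@filterI _ _ _ _ _ bx' bx).
Unshelve. all: by end_near. Qed.

End Below.

(** * Signed decomposition of a slice of a simplex *)

Section Slices.
Variable R : realType.

(** The term of index i is 1 when lam k is negative for k < i and positive for k > i.
    Splitting it according to the sign of lam i makes the alternating sum telescope.
    The end of the telescope at the threshold t vanishes, as otherwise all terms of
    the sum of lam k (tau k - t) would have the same sign. *)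
Lemma slice_sign_identity n (lam tau : nat -> R) (t : R) :
  (0 < n)%N -> {homo tau : i j / (i < j <= n)%N >-> i < j} ->
  (forall i, (i <= n)%N -> lam i != 0) ->
  \sum_(i < n.+1) lam i * (tau i - t) = 0 ->
  [forall i : 'I_n.+1, 0 < lam i]%:R =
  \sum_(i < n.+1 | tau i < t) (-1) ^+ i *
    [forall k : 'I_n.+1, (k != i) ==> (0 < lam k * (tau k - tau i))]%:R :> R.
Proof.
move=> n0 tau_mono lam0 lam_t.
(* Sign pattern with a single change of sign, at index i. *)
pose G i := [forall k : 'I_n.+1, if (k < i)%N then lam k < 0 else 0 < lam k].
have le_tau i j : (i <= j <= n)%N -> tau i <= tau j.
  rewrite leq_eqVlt => /andP[/orP[/eqP ->//|ij jn]].
  by apply/ltW/tau_mono; rewrite ij.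
have ordN (i : 'I_n.+1) : (i <= n)%N by rewrite -ltnS.
have G_term (i : 'I_n.+1) :
    [forall k : 'I_n.+1, (k != i) ==> (0 < lam k * (tau k - tau i))]%:R =
    (G i)%:R + (G i.+1)%:R :> R.
  have side (k : 'I_n.+1) : k != i ->
      (0 < lam k * (tau k - tau i)) = if (k < i)%N then lam k < 0 else 0 < lam k.
    rewrite -val_eqE; case: ltngtP => // [ki|ik] _.
      by rewrite nmulr_lgt0// subr_lt0; apply: tau_mono; rewrite ki ordN.
    by rewrite pmulr_lgt0// subr_gt0; apply: tau_mono; rewrite ik ordN.
  have [li|li|li] := ltgtP (lam i) 0; last by have := lam0 i (ordN i); rewrite li eqxx.
  - have -> : G i = false.
      by apply/negbTE/forallPn; exists i; rewrite ltnn ltNge (ltW li).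
    rewrite add0r; congr (_%:R); congr nat_of_bool; apply: eq_forallb => k.
    rewrite ltnS leq_eqVlt; have [->|ki] := eqVneq k i; first by rewrite eqxx li.
    by rewrite (_ : (k == i :> nat) = false) ?side//; exact: negPf ki.
  - have -> : G i.+1 = false.
      by apply/negbTE/forallPn; exists i; rewrite ltnSn ltNge (ltW li).
    rewrite addr0; congr (_%:R); congr nat_of_bool; apply: eq_forallb => k.
    have [->|ki] := eqVneq k i; first by rewrite ltnn li.
    by rewrite side.
have cancel_sum (j : 'I_n.+1) (F : 'I_n.+1 -> R) :
    \sum_i F i = 0 -> (forall i, 0 <= F i) -> 0 < F j -> False.
  by move=> F0 Fp; rewrite (psumr_eq0P _ F0)// ltxx.
have G0 : ~~ (tau 0%N < t) -> G 0%N = false.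
  rewrite -leNgt => t0; apply/negP => /forallP G0.
  apply: (cancel_sum (Ordinal (n0 : 1 < n.+1)%N) _ lam_t) => [i|].
    by rewrite mulr_ge0 ?(ltW (G0 i))// subr_ge0 (le_trans t0)// le_tau// ordN.
  by rewrite mulr_gt0 ?(G0 (Ordinal _))// subr_gt0 (le_lt_trans t0)// tau_mono.
have Gm m : (m <= n)%N -> tau m < t -> ((m < n)%N -> ~~ (tau m.+1 < t)) ->
    G m.+1 = false.
  move=> mn tm tSm; apply/negP => /forallP Gm.
  apply: (cancel_sum (Ordinal (mn : m < n.+1)%N) _ lam_t) => [i|].
    have := Gm i; rewrite ltnS; case: leqP => [im li|mi li].
      by rewrite mulr_le0 ?(ltW li)// subr_le0 (le_trans _ (ltW tm))// le_tau// im mn.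
    rewrite mulr_ge0 ?(ltW li)// subr_ge0.
    by rewrite (@le_trans _ _ (tau m.+1))// ?le_tau ?mi ?ordN// leNgt tSm// (leq_trans mi)// ordN.
  have := Gm (Ordinal (mn : m < n.+1)%N); rewrite /= ltnSn => lm.
  by rewrite nmulr_rgt0// subr_lt0.
have tele m : (m <= n)%N ->
    \sum_(i < m.+1 | tau i < t) (-1) ^+ i * ((G i)%:R + (G i.+1)%:R) =
    (G 0%N)%:R - (-1) ^+ m.+1 * ((tau m < t) && G m.+1)%:R :> R.
  elim: m => [_|m IH mn].
    rewrite big_mkcond big_ord_recl big_ord0 /= addr0 expr1.
    case: ifPn => /= t0; first by rewrite expr0; ring.
    by rewrite (G0 t0) mulr0 subr0.
  rewrite big_mkcond big_ord_recr/= -big_mkcond/= IH ?(ltnW mn)//.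
  case: ifPn => /= t1.
    rewrite (lt_trans _ t1) ?tau_mono ?ltnSn//= [in RHS]exprS; ring.
  rewrite mulr0 subr0 addr0; case: (boolP (tau m < t)) => /= tm; last by rewrite mulr0 subr0.
  by rewrite Gm ?(ltnW mn)// mulr0 subr0.
under [RHS]eq_bigr do rewrite G_term.
rewrite tele// (_ : (tau n < t) && _ = false).
  by rewrite mulr0 subr0.
by apply/negP => /andP[tn]; rewrite Gm// ltnn.
Qed.

Lemma vcons0 d t (y : 'rV[R]_d) : vcons t y 0 ord0 = t.
Proof. by rewrite mxE unlift_none. Qed.

Lemma vconsS d t (y : 'rV[R]_d) j : vcons t y 0 (lift ord0 j) = y 0 j.
Proof. by rewrite mxE liftK. Qed.

Lemma vcons_tail d (x : 'rV[R]_d.+1) : vcons (x 0 ord0) (tail x) = x.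
Proof.
apply/rowP => j; case: (unliftP ord0 j) => [k|] ->; first by rewrite vconsS mxE.
by rewrite vcons0.
Qed.

Lemma vcons_lower d t (y : 'rV[R]_d.+1) e :
  vcons t y - e *: elast R d.+1 = vcons t (y - e *: elast R d).
Proof.
apply/rowP => j; case: (unliftP ord0 j) => [k|] ->.
  by rewrite vconsS [LHS]mxE vconsS !mxE.
by rewrite vcons0 [LHS]mxE vcons0 !mxE mulr0 subr0.
Qed.

Definition slice_simplex d (a : 'I_d.+3 -> 'rV[R]_d.+2) i t k : 'rV[R]_d.+1 :=
  tail (a i) + (t - a i 0 ord0) *: slope a i k.

Lemma bar_first d (a : 'I_d.+2 -> 'rV[R]_d.+1) x : affinely_independent a ->
  \sum_i bar a 1 x i * (a i 0 ord0 - x 0 ord0) = 0.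
Proof.
move=> aff_a; under eq_bigr do rewrite mulrBr.
rewrite sumrB -mulr_suml bar_sum// mul1r -[in X in _ - X](bar_comb aff_a 1 x).
by rewrite summxE; apply/eqP; rewrite subr_eq0; apply/eqP; apply: eq_bigr => i _; rewrite mxE.
Qed.

Lemma osimp_first_lt d (a : 'I_d.+2 -> 'rV[R]_d.+1) x t : affinely_independent a ->
  osimp a x -> (forall i, a i 0 ord0 < t) -> x 0 ord0 < t.
Proof.
move=> aff_a ax at_; rewrite ltNge; apply/negP => tx.
have := bar_first x aff_a; rewrite (bigD1 ord0)//= => /eqP; apply/negP; rewrite lt_eqF//.
have neg i : bar a 1 x i * (a i 0 ord0 - x 0 ord0) < 0.
  by rewrite pmulr_rlt0// subr_lt0 (lt_le_trans (at_ i)).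
by rewrite (le_lt_trans _ (neg ord0))// gerDl sumr_le0// => i _; exact: ltW.
Qed.

Lemma osimp_first_gt d (a : 'I_d.+2 -> 'rV[R]_d.+1) x t : affinely_independent a ->
  osimp a x -> (forall i, t < a i 0 ord0) -> t < x 0 ord0.
Proof.
move=> aff_a ax at_; rewrite ltNge; apply/negP => tx.
have := bar_first x aff_a; rewrite (bigD1 ord0)//= => /eqP; apply/negP; rewrite gt_eqF//.
have pos i : 0 < bar a 1 x i * (a i 0 ord0 - x 0 ord0).
  by rewrite pmulr_rgt0// subr_gt0 (le_lt_trans tx).
by rewrite (lt_le_trans (pos ord0))// lerDl sumr_ge0// => i _; exact: ltW.
Qed.

Section Slice.
Variables (d : nat) (a : 'I_d.+3 -> 'rV[R]_d.+2) (t : R).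
Hypothesis latt : lattice_position a.

Let tau i := a i 0 ord0.

Lemma tau_lift i k : tau (lift i k) - tau i != 0.
Proof.
rewrite subr_eq0; apply/eqP => /(lattice_position_first_inj latt)/eqP.
by rewrite eq_sym (negPf (neq_lift _ _)).
Qed.

Lemma lattice_position_slice i : t \is a Num.int -> tau i < t ->
  lattice_position (slice_simplex a i t).
Proof.
move=> tZ it; have /natrP[m mE] : t - tau i \is a Num.nat.
  by rewrite -intrEge0 ?rpredB ?lattice_position_int// subr_ge0 ltW.
rewrite /slice_simplex -/(tau i) mE; apply: (@lattice_position_place _ _ (tail (a i)) m (slope a i)).
- by rewrite -(@ltr_nat R) -mE subr_gt0.
- by move=> j; rewrite mxE lattice_position_int.
- exact: lattice_position_slope.
Qed.

Lemma bar_slice i y k : affinely_independent (slice_simplex a i t) -> tau i < t ->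
  bar (slice_simplex a i t) 1 y k =
  bar a 1 (vcons t y) (lift i k) * (tau (lift i k) - tau i) / (t - tau i).
Proof.
move=> aff_b it; have ti0 : t - tau i != 0 by rewrite subr_eq0 gt_eqF.
have [aff_a _] := latt; set b := bar a 1 (vcons t y).
have sum_b : \sum_k b (lift i k) * (tau (lift i k) - tau i) = t - tau i.
  transitivity (\sum_k b k * (tau k - tau i)).
    by rewrite [RHS](bigD1_ord i)//= subrr mulr0 add0r.
  have := bar_first (vcons t y) aff_a; rewrite vcons0 -/b => bf.
  rewrite -[RHS]addr0 -[X in _ = _ + X]bf -[in RHS](mul1r (t - tau i)).
  rewrite -[in RHS](bar_sum aff_a 1 (vcons t y)) -/b mulr_suml -big_split/=.
  by apply: eq_bigr => l _; rewrite -/(tau l); ring.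
apply: (bar_eq aff_b (w := fun k => b (lift i k) * (tau (lift i k) - tau i) / (t - tau i))).
  by rewrite -mulr_suml sum_b divff.
apply/rowP => j; rewrite summxE.
transitivity (\sum_k (b (lift i k) * (tau (lift i k) - tau i) / (t - tau i) *
    a i 0 (lift ord0 j) + b (lift i k) * (a (lift i k) 0 (lift ord0 j) - a i 0 (lift ord0 j)))).
  apply: eq_bigr => l _; have := tau_lift i l; rewrite !mxE -/(tau i) -/(tau _) => tl.
  by rewrite mulrDr; congr (_ + _); field; rewrite tl ti0.
rewrite big_split/= -mulr_suml -mulr_suml sum_b divff// mul1r.
transitivity (a i 0 (lift ord0 j) + \sum_k b k * (a k 0 (lift ord0 j) - a i 0 (lift ord0 j))).
  by congr (_ + _); rewrite [RHS](bigD1_ord i)//= subrr mulr0 add0r.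
under eq_bigr do rewrite mulrBr.
rewrite sumrB -mulr_suml bar_sum// mul1r addrC subrK.
rewrite -(vconsS t y j) -[in RHS](bar_comb aff_a 1 (vcons t y)) summxE.
by apply: eq_bigr => l _; rewrite mxE.
Qed.

Hypothesis tau_mono : forall i j : 'I_d.+3, (i < j)%N -> tau i < tau j.

(** A simplex is the alternating sum of the cones at its vertices, flipped so as to
    point towards larger first coordinates (Lawrence). A slice of such a cone is again
    a simplex in lattice position. Boundaries cause no trouble, because lowering a
    point does not move its first coordinate and makes all barycentric coordinates
    nonzero. *)
Lemma below_slice y : t \is a Num.int ->
  `[< below (osimp a) (vcons t y) >]%:R =
  \sum_(i | tau i < t) (-1) ^+ i * `[< below (osimp (slice_simplex a i t)) y >]%:R :> R.
Proof.
move=> tZ; have [aff_a _] := latt.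
have : \forall e \near 0^'+, [/\ forall i, bar a 1 (vcons t y - e *: elast R d.+1) i != 0,
    osimp a (vcons t y - e *: elast R d.+1) <-> below (osimp a) (vcons t y) &
    forall i, tau i < t -> osimp (slice_simplex a i t) (y - e *: elast R d) <->
      below (osimp (slice_simplex a i t)) y].
  have h1 := near_bar_neq0 (vcons t y) latt.
  have h2 := near_below (vcons t y) latt.
  have h3 : \forall e \near 0^'+, forall i, tau i < t ->
      osimp (slice_simplex a i t) (y - e *: elast R d) <->
      below (osimp (slice_simplex a i t)) y.
    apply: filter_forall => i; have [it|it] := ltP (tau i) t; last first.
      by exact: filterE.
    have := near_below y (lattice_position_slice tZ it).
    by apply: filterS => e + _.
  by near=> e; split; near: e.
move=> /filter_ex[e [bar0 bel_a bel_b]].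
set x := vcons t y - e *: elast R d.+1 in bar0 bel_a.
have xE : x = vcons t (y - e *: elast R d) by rewrite /x vcons_lower.
pose lam (k : nat) := bar a 1 x (inord k).
pose ta (k : nat) := tau (inord k).
have osimpE : `[< below (osimp a) (vcons t y) >] = [forall k : 'I_d.+3, 0 < lam k].
  apply/asboolP/forallP => [/bel_a ax k|ax]; first by rewrite /lam inord_val.
  by apply/bel_a => k; have := ax k; rewrite /lam inord_val.
rewrite osimpE (@slice_sign_identity _ lam ta t) //.
- apply: eq_big => [i|i]; rewrite /ta inord_val// => it; congr (_ * _%:R); congr nat_of_bool.
  have [aff_b _] := lattice_position_slice tZ it.
  have bE k : (0 < bar (slice_simplex a i t) 1 (y - e *: elast R d) k) =
      (0 < lam (lift i k) * (tau (inord (lift i k)) - tau i)).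
    rewrite bar_slice// -xE /lam !inord_val pmulr_lgt0//.
    by rewrite invr_gt0 subr_gt0.
  apply/forallP/asboolP => [pos|/(bel_b _ it) pos k].
    apply/(bel_b _ it) => k; rewrite bE.
    by apply: (implyP (pos (lift i k))); rewrite eq_sym neq_lift.
  apply/implyP => ki; case: (unliftP i k) ki => [l ->|->]; last by rewrite eqxx.
  by rewrite -bE.
- by move=> i j /andP[ij jn]; apply: tau_mono; rewrite !inordK// ltnS (leq_trans (ltnW ij)).
- by move=> i _; exact: bar0.
- have := bar_first x aff_a; rewrite {2}xE vcons0 => bf; rewrite -[RHS]bf.
  by apply: eq_bigr => i _; rewrite /lam /ta inord_val.
Unshelve. all: by end_near. Qed.

End Slice.

End Slices.

(** * Sums of truncated powers over the integers *)

Section PowerSums.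
Variable R : realType.

(** Faulhaber's formula, obtained by telescoping the differences of u^(D+1). *)
Lemma power_sum_poly D : exists2 Q : {poly R}, (size Q <= D.+2)%N &
  forall n, Q.[n%:R] = \sum_(s < n) s.+1%:R ^+ D.
Proof.
have [N] := ubnP D; elim: N D => // N IH D /ltnSE DN.
pose co (l : nat) : R := - ((-1) ^+ (D.+1 - l) *+ 'C(D.+1, l)).
have [Q HQ] : exists Q : 'I_D -> {poly R}, forall l, (size (Q l) <= l.+2)%N /\
    forall n, (Q l).[n%:R] = \sum_(s < n) s.+1%:R ^+ l.
  apply: (@fin_all_exists _ (fun=> {poly R}) (fun (l : 'I_D) Q => (size Q <= l.+2)%N /\
    forall n, Q.[n%:R] = \sum_(s < n) s.+1%:R ^+ l)) => l.
  by have [|Q sQ QE] := IH l; [exact: leq_trans (ltn_ord l) DN|exists Q].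
have D0 : D.+1%:R != 0 :> R by rewrite pnatr_eq0.
exists (D.+1%:R^-1 *: ('X^(D.+1) - \sum_(l < D) co l *: Q l)).
  apply: (leq_trans (size_scale_leq _ _)).
  rewrite (leq_trans (size_polyD _ _))// geq_max size_polyXn leqnn /= size_polyN.
  apply: (leq_trans (size_sum _ _ _)); apply/bigmax_leqP => l _.
  apply: (leq_trans (size_scale_leq _ _)); apply: (leq_trans (HQ l).1).
  by rewrite !ltnS ltnW.
have diff (u : R) : u ^+ D.+1 - (u - 1) ^+ D.+1 = \sum_(l < D.+1) co l * u ^+ l.
  rewrite [u - 1]addrC exprDn big_ord_recr/= subnn expr0 mul1r binn mulr1n.
  rewrite opprD addrCA subrr addr0 -sumrN; apply: eq_bigr => l _.
  by rewrite /co mulNr mulrnAl.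
have coD : co D = D.+1%:R by rewrite /co subSnn expr1 mulNrn opprK binSn.
move=> n; rewrite hornerZ hornerD hornerXn hornerN horner_sum.
apply: (mulfI D0); rewrite mulrA divff// mul1r.
have -> : n%:R ^+ D.+1 = \sum_(s < n) \sum_(l < D.+1) co l * s.+1%:R ^+ l.
  under eq_bigr do rewrite -diff -[X in (X - 1)]natr1 addrK.
  by rewrite -(big_mkord xpredT (fun s => s.+1%:R ^+ D.+1 - s%:R ^+ D.+1))
    telescope_sumr// expr0n subr0.
under eq_bigr do rewrite big_ord_recr/=.
rewrite big_split/= exchange_big/= -mulr_sumr coD addrAC -[RHS]add0r; congr (_ + _).
apply/eqP; rewrite subr_eq0; apply/eqP/eq_bigr => l _.
by rewrite hornerZ (HQ l).2 mulr_sumr.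
Qed.

Definition ints (M : nat) : seq R :=
  [seq i%:R - M%:R | i <- index_iota 0 M.*2.+1].

Lemma sum_ints_gt (c : R) (M : nat) (F : R -> R) :
  c \is a Num.int -> - M%:R <= c <= M%:R ->
  exists2 n, M%:R - c = n%:R &
    \sum_(t <- ints M | c < t) F (t - c) = \sum_(s < n) F s.+1%:R.
Proof.
move=> cZ /andP[cl cu].
have /natrP[n nE] : M%:R - c \is a Num.nat.
  by rewrite -intrEge0 ?rpredB ?natr_int// subr_ge0.
have /natrP[k kE] : c + M%:R \is a Num.nat.
  by rewrite -intrEge0 ?rpredD ?natr_int// -[M%:R]opprK subr_ge0.
have nk : (M.*2 = n + k)%N.
  apply/eqP; rewrite -(@eqr_nat R) natrD -nE -kE -addnn natrD; apply/eqP; ring.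
exists n => //; rewrite big_map.
have -> : \sum_(0 <= j < M.*2.+1 | c < j%:R - M%:R) F (j%:R - M%:R - c) =
    \sum_(0 <= j < M.*2.+1 | true && (k.+1 <= j)%N) F (j%:R - k%:R).
  apply: eq_big => j; rewrite -?kE; first by rewrite -(@ltr_nat R) -kE ltrBrDr.
  by move=> _; congr F; ring.
rewrite -(big_nat_widenl _ _ _ xpredT)// nk -[k.+1]add0n big_addn subSS addnK big_mkord.
by apply: eq_bigr => s _; congr F; rewrite -addSnnS natrD addrK.
Qed.

(** A spline with integer knots that vanishes beyond its last knot has weights w whose
    moments of order at most D vanish. Its sum over the integers is the combination
    with weights w of the values of a polynomial of degree D + 1 at the knots; only
    the leading term survives, so it is homogeneous in the knots. *)
Lemma truncated_power_sum N (w tau : 'I_N -> R) D :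
  (forall i, tau i \is a Num.int) ->
  (forall t, t \is a Num.int -> (forall i, tau i < t) ->
    \sum_i w i * (t - tau i) ^+ D = 0) ->
  exists K : R, forall (p : R) (m M : nat), p \is a Num.int ->
    (forall i, - M%:R <= p + m%:R * tau i <= M%:R) ->
    \sum_(t <- ints M) \sum_(i | p + m%:R * tau i < t)
       w i * (t - (p + m%:R * tau i)) ^+ D = m%:R ^+ D.+1 * K.
Proof.
move=> tauZ van.
(* Vanishing at all large integers makes the polynomial in t zero. *)
have moment0 l : (l <= D)%N -> \sum_i w i * tau i ^+ l = 0.
  move=> lD; pose q : {poly R} := \sum_i w i *: ('X - (tau i)%:P) ^+ D.
  have qE t : q.[t] = \sum_i w i * (t - tau i) ^+ D.
    by rewrite horner_sum; apply: eq_bigr => i _; rewrite hornerZ horner_exp hornerXsubC.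
  have q0 : q = 0.
    apply/eqP/negPn/negP => qn0.
    pose b := \sum_i (`|tau i| + 1).
    have tau_b i : tau i < b + 1.
      have : `|tau i| + 1 <= b.
        by rewrite /b (bigD1 i)//= lerDl sumr_ge0// => j _; rewrite addr_ge0.
      by have := ler_norm (tau i); lra.
    pose rs := [seq (b + 1) + s%:R | s <- iota 0 (size q)].
    have bZ : b \is a Num.int.
      by rewrite rpred_sum// => i _; rewrite rpredD// intr_nat// natr_norm_int.
    suff : (size rs < size q)%N by rewrite size_map size_iota ltnn.
    apply: max_poly_roots => //.
      apply/allP => _ /mapP[s _ ->]; rewrite rootE qE; apply/eqP/van.
        by rewrite rpredD ?natr_int// rpredD// rpred1.
      by move=> i; rewrite (lt_le_trans (tau_b i))// lerDl.
    rewrite map_inj_uniq ?iota_uniq// => x y /addrI/eqP; rewrite eqr_nat => /eqP//.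
  have := congr1 (fun r : {poly R} => r`_(D - l)) q0.
  rewrite coef_sum coef0.
  have sgnC j : (-1) ^+ j = ((-1) ^+ j)%:P :> {poly R} by rewrite polyC_exp polyCN.
  have -> : \sum_i (w i *: ('X - (tau i)%:P) ^+ D)`_(D - l) =
      ((-1) ^+ l *+ 'C(D, l)) * \sum_i w i * tau i ^+ l.
    rewrite mulr_sumr; apply: eq_bigr => i _.
    rewrite coefZ exprBn coef_sum (bigD1 (Ordinal (lD : l < D.+1)%N))//= big1 ?addr0.
      rewrite coefMn -polyC_exp coefMC sgnC coefCM.
      by rewrite coefXn eqxx; rewrite mulr1 mulrnAr mulrnAl mulrCA.
    move=> j jl; rewrite coefMn -polyC_exp coefMC sgnC coefCM coefXn.
    case: eqP => [e|_]; last by rewrite mulr0 mul0r mul0rn.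
    case/eqP: jl; apply/val_inj => /=; have := ltn_ord j; lia.
  move=> /eqP; rewrite mulf_eq0 mulrn_eq0 signr_eq0 orbF.
  by rewrite -leqn0 leqNgt bin_gt0 lD/= => /eqP.
have [Q sQ QE] := power_sum_poly D.
exists (Q`_D.+1 * (-1) ^+ D.+1 * \sum_i w i * tau i ^+ D.+1) => p m M pZ box.
have cZ i : p + m%:R * tau i \is a Num.int by rewrite rpredD ?rpredM ?natr_int.
under eq_bigr do rewrite big_mkcond/=.
rewrite exchange_big/=.
under eq_bigr => i _ do rewrite -big_mkcond/= -mulr_sumr.
have -> : \sum_i w i *
      (\sum_(t <- ints M | p + m%:R * tau i < t) (t - (p + m%:R * tau i)) ^+ D) =
    \sum_i w i * Q.[M%:R - p - m%:R * tau i].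
  apply: eq_bigr => i _; congr (_ * _).
  have [n nE ->] := sum_ints_gt (fun u => u ^+ D) (cZ i) (box i).
  by rewrite -QE -nE opprD addrA.
under [LHS]eq_bigr => i _ do rewrite (horner_coef_wide _ sQ) mulr_sumr.
rewrite exchange_big/=.
have inner j : (j <= D.+1)%N ->
    \sum_i w i * (Q`_j * (M%:R - p - m%:R * tau i) ^+ j) =
    if j == D.+1 then Q`_j * (- m%:R) ^+ j * \sum_i w i * tau i ^+ j else 0.
  move=> jD.
  under eq_bigr do rewrite exprDn !mulr_sumr.
  rewrite exchange_big/= big_ord_recr/= big1 ?add0r; last first.
    move=> l _.
    transitivity (Q`_j * (M%:R - p) ^+ (j - l) * (- m%:R) ^+ l *+ 'C(j, l) *
        \sum_i w i * tau i ^+ l).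
      rewrite mulr_sumr; apply: eq_bigr => i _; rewrite -mulNr exprMn.
      rewrite !mulrnAr mulrnAl; congr (_ *+ _).
      move: (_ ^+ (j - l)) ((- m%:R) ^+ l) (tau i ^+ l) => x y z; ring.
    by rewrite moment0 ?mulr0// -ltnS (leq_trans (ltn_ord l)).
  transitivity (Q`_j * (- m%:R) ^+ j * \sum_i w i * tau i ^+ j).
    rewrite mulr_sumr; apply: eq_bigr => i _.
    rewrite subnn expr0 mul1r binn mulr1n -mulNr exprMn.
    by move: ((- m%:R) ^+ j) (tau i ^+ j) => x y; ring.
  case: eqP => // jD'; rewrite moment0 ?mulr0//; lia.
rewrite (eq_bigr _ (fun (j : 'I_D.+2) _ => inner j (ltn_ord j))).
rewrite big_ord_recr/= eqxx big1 ?add0r; last first.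
  by move=> j _; rewrite (ltn_eqF (ltn_ord j)).
rewrite exprNn; move: (_ ^+ D.+1) (m%:R ^+ D.+1) (\sum_i _) => x y z; ring.
Qed.

End PowerSums.

(** * Boxes of lattice points *)

Section Boxes.
Variable R : realType.

Lemma mem_ints (t : R) M : t \in ints R M = (t \is a Num.int) && (`|t| <= M%:R).
Proof.
apply/mapP/andP => [[i]|[tZ]].
  rewrite mem_index_iota ltnS => /= iM ->.
  split; first by rewrite rpredB ?natr_int.
  rewrite ler_norml; have := ler0n R i; have : i%:R <= M.*2%:R :> R by rewrite ler_nat.
  by rewrite -addnn natrD; lra.
rewrite ler_norml => /andP[tl tu].
have /natrP[k kE] : t + M%:R \is a Num.nat.
  by rewrite -intrEge0 ?rpredD ?natr_int// -[M%:R]opprK subr_ge0.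
exists k; last by rewrite -kE addrK.
by rewrite mem_index_iota /= ltnS -(@ler_nat R k) -kE -addnn natrD lerD2r.
Qed.

Lemma uniq_ints M : uniq (ints R M).
Proof.
rewrite map_inj_uniq ?iota_uniq// => i j /addIr/eqP; rewrite eqr_nat => /eqP//.
Qed.

Fixpoint box (M : nat) (d : nat) : seq 'rV[R]_d :=
  match d with
  | 0 => [:: 0]
  | d'.+1 => [seq vcons t y | t <- ints R M, y <- box M d']
  end.

Lemma mem_box M d (x : 'rV[R]_d) :
  x \in box M d <-> forall j, x 0 j \is a Num.int /\ `|x 0 j| <= M%:R.
Proof.
elim: d x => [|d IH] x.
  split=> [_ []//|_]; rewrite inE; apply/eqP/rowP => -[]//.
split=> [xB j|xM].
  have [[t y] [/= tM /IH yM ->]] := allpairsP xB.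
  case: (unliftP ord0 j) => [k|] ->; first by rewrite vconsS.
  by move: tM; rewrite mem_ints vcons0 => /andP[].
apply/allpairsP; exists (x 0 ord0, tail x); rewrite /= vcons_tail; split=> //.
  by rewrite mem_ints; apply/andP.
by apply/IH => j; rewrite mxE.
Qed.

Lemma uniq_box M d : uniq (box M d).
Proof.
elim: d => // d IH; apply: allpairs_uniq => //; first exact: uniq_ints.
by move=> [t y] [t' y'] _ _ /= /vcons_inj[-> ->].
Qed.

Definition box_count (M d : nat) (A : set 'rV[R]_d) : R :=
  \sum_(x <- box M d) `[< A x >]%:R.

Lemma box_countS M d (A : set 'rV[R]_d.+1) :
  box_count M A = \sum_(t <- ints R M) \sum_(y <- box M d) `[< A (vcons t y) >]%:R.
Proof. exact: big_allpairs_dep. Qed.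

Lemma sorting_reindex n (tau : 'I_n.+1 -> R) : injective tau ->
  exists2 f : 'I_n.+1 -> 'I_n.+1, injective f &
    forall i j : 'I_n.+1, (i < j)%N -> tau (f i) < tau (f j).
Proof.
move=> tau_inj; pose s := sort (relpre tau <=%R) (enum 'I_n.+1).
have ss : size s = n.+1 by rewrite size_sort size_enum_ord.
have us : uniq s by rewrite sort_uniq enum_uniq.
exists (fun i => nth ord0 s i).
  by move=> i j /eqP; rewrite nth_uniq ?ss// => /eqP/val_inj.
move=> i j ij; rewrite lt_neqAle (inj_eq tau_inj) nth_uniq ?ss//.
rewrite (ltn_eqF ij)/=.
have srt : sorted (relpre tau <=%R) s by apply: sort_sorted => x y; exact: le_total.
have tr : transitive (relpre tau <=%R) by move=> x y z; exact: le_trans.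
by apply: (sorted_ltn_nth tr ord0 srt) => //; rewrite inE ss.
Qed.

Section Reindex.
Variables (d : nat) (a : 'I_d.+1 -> 'rV[R]_d) (f : 'I_d.+1 -> 'I_d.+1).
Hypothesis f_inj : injective f.

Lemma affinely_independent_reindex :
  affinely_independent a -> affinely_independent (a \o f).
Proof.
move=> aff_a w w0 wa i; have [g gK fK] := injF_bij f_inj.
rewrite -(gK i); apply: (aff_a (w \o g)).
  by rewrite (reindex_inj f_inj)/= -[RHS]w0; apply: eq_bigr => j _; rewrite /= gK.
by rewrite (reindex_inj f_inj)/= -[RHS]wa; apply: eq_bigr => j _; rewrite /= gK.
Qed.

Lemma bar_reindex c x i : affinely_independent a -> bar (a \o f) c x i = bar a c x (f i).
Proof.
move=> aff_a; apply: (bar_eq (affinely_independent_reindex aff_a) (w := bar a c x \o f)).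
  by rewrite -[RHS](bar_sum aff_a c x) [RHS](reindex_inj f_inj).
by rewrite -[RHS](bar_comb aff_a c x) [RHS](reindex_inj f_inj).
Qed.

Lemma osimp_reindex : affinely_independent a -> osimp (a \o f) = osimp a.
Proof.
move=> aff_a; have [g gK fK] := injF_bij f_inj.
apply/seteqP; split => x ax i; last by rewrite bar_reindex.
by have := ax (g i); rewrite bar_reindex// fK.
Qed.

Lemma lattice_position_reindex : lattice_position a -> lattice_position (a \o f).
Proof.
move=> [aff_a latt]; split; first exact: affinely_independent_reindex.
move=> k S Sk; have [|c0 [c [c0Z cZ ak]]] := latt k (imset f (mem S)).
  by rewrite card_imset.
by exists c0, c; split=> // i iS; rewrite ak// imset_f.
Qed.

End Reindex.

Lemma place_slope d (p : 'rV[R]_d.+2) m (a : 'I_d.+3 -> 'rV[R]_d.+2) i k :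
  (0 < m)%N -> slope (place p m a) i k = slope a i k.
Proof.
move=> m0; have mn0 : m%:R != 0 :> R by rewrite pnatr_eq0 -lt0n.
apply/rowP => j; rewrite !mxE.
have -> : p 0 ord0 + m%:R * a (lift i k) 0 ord0 - (p 0 ord0 + m%:R * a i 0 ord0) =
  m%:R * (a (lift i k) 0 ord0 - a i 0 ord0) by ring.
rewrite invfM.
have -> : p 0 (lift ord0 j) + m%:R * a (lift i k) 0 (lift ord0 j) -
    (p 0 (lift ord0 j) + m%:R * a i 0 (lift ord0 j)) =
  m%:R * (a (lift i k) 0 (lift ord0 j) - a i 0 (lift ord0 j)) by ring.
by rewrite mulrACA mulVf// mul1r.
Qed.

Lemma below_interval (a : 'I_2 -> 'rV[R]_1) x : affinely_independent a ->
  a ord0 0 ord0 < a ord_max 0 ord0 ->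
  below (osimp a) x <-> a ord0 0 ord0 < x 0 ord0 <= a ord_max 0 ord0.
Proof.
move=> aff_a; set t0 := a ord0 0 ord0; set t1 := a ord_max 0 ord0 => t01.
have x0E e : (x - e *: elast R 0) 0 ord0 = x 0 ord0 - e.
  by rewrite !mxE eqxx mulr1.
have barE y : osimp a y <-> t0 < y 0 ord0 < t1.
  have d0 : t1 - t0 != 0 by rewrite subr_eq0 gt_eqF.
  pose w (i : 'I_2) := (if i == ord0 then t1 - y 0 ord0 else y 0 ord0 - t0) / (t1 - t0).
  have wE : bar a 1 y =1 w.
    apply: (bar_eq aff_a); rewrite big_ord_recl big_ord1 /w/=; first by field.
    apply/rowP => j; rewrite (ord1 j) !mxE -/t0.
    rewrite (_ : lift ord0 ord0 = ord_max) -/t1; last exact/val_inj.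
    by field.
  split=> [yin|/andP[y0 y1] i].
    have := yin ord0; have := yin ord_max.
    by rewrite !wE /w/= !pmulr_lgt0 ?invr_gt0 ?subr_gt0// => -> ->.
  by rewrite wE divr_gt0 ?subr_gt0//; case: ifP => _; rewrite subr_gt0.
have e0 : \forall e \near 0^'+, 0 < e :> R by exact: nbhs_right_gt.
split=> [bx|/andP[x0 x1]].
  have lt0 : t0 < x 0 ord0.
    have [e [/barE]] := filter_ex (@filterI _ _ _ _ _ bx e0).
    by rewrite x0E => /andP[+ _]; lra.
  rewrite lt0 leNgt; apply/negP => lt1.
  have := near0_pos (p := x 0 ord0 - t1) (-1); rewrite subr_gt0 => /(_ lt1) h.
  have [e [/barE]] := filter_ex (@filterI _ _ _ _ _ bx h).
  by rewrite x0E => /andP[_]; lra.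
have := near0_pos (p := x 0 ord0 - t0) (-1); rewrite subr_gt0 => /(_ x0) h.
near=> e; apply/barE; rewrite x0E.
have : 0 < x 0 ord0 - t0 + e * -1 by near: e.
have : 0 < e by near: e.
by move=> ? ?; apply/andP; split; lra.
Unshelve. all: by end_near. Qed.

End Boxes.

(** * Homogeneity of the number of lattice points *)

Section Homogeneity.
Variable R : realType.

Lemma place_first d (p : 'rV[R]_d.+1) m (a : 'I_d.+2 -> 'rV[R]_d.+1) i :
  place p m a i 0 ord0 = p 0 ord0 + m%:R * a i 0 ord0.
Proof. by rewrite !mxE. Qed.

(** Translations are included because the slices of a cone at integers are lattice
    translates of dilations of one simplex. *)
Definition homogeneous_count d (a : 'I_d.+2 -> 'rV[R]_d.+1) (K : R) :=
  forall (p : 'rV[R]_d.+1) (m : nat), (forall j, p 0 j \is a Num.int) -> (0 < m)%N ->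
    \forall M \near \oo, box_count M (below (osimp (place p m a))) = m%:R ^+ d.+1 * K.

Lemma bound_nat n (f : 'I_n -> R) : exists M : nat, forall i, `|f i| <= M%:R.
Proof.
exists (Num.bound (\sum_i `|f i|)) => i.
rewrite (le_trans _ (ltW (archi_boundP _)))// ?sumr_ge0//.
by rewrite (bigD1 i)//= lerDl sumr_ge0.
Qed.

Lemma homogeneous_count_interval (a : 'I_2 -> 'rV[R]_1) : lattice_position a ->
  a ord0 0 ord0 < a ord_max 0 ord0 -> exists K, homogeneous_count a K.
Proof.
move=> latt a01; pose tau i := a i 0 ord0.
have [|t tZ tt|K HK] :=
  @truncated_power_sum R 2 (fun i => (-1) ^+ i) tau 0.
- by move=> i; exact: lattice_position_int.
- by rewrite !big_ord_recl big_ord0; rewrite /= !expr0 expr1; ring.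
exists K => p m pZ m0.
have pm := lattice_position_place m0 pZ latt.
have [M0 HM0] := bound_nat (fun i => p 0 ord0 + m%:R * tau i).
near=> M; have M0M : M0%:R <= M%:R :> R by rewrite ler_nat; near: M; exact: nbhs_infty_ge.
rewrite box_countS -(HK (p 0 ord0) m M) ?pZ//; last first.
  by move=> i; rewrite -ler_norml (le_trans (HM0 i)).
apply: eq_bigr => t _; rewrite big_seq1.
rewrite (_ : `[< _ >] = (place p m a ord0 0 ord0 < t <= place p m a ord_max 0 ord0));
  last first.
  apply/asboolP/idP => [|h].
    by move=> /(below_interval _ pm.1); rewrite vcons0 !place_first; apply;
      rewrite ltrD2l ltr_pM2l ?ltr0n.
  by apply/(below_interval _ pm.1); rewrite ?vcons0// !place_first ltrD2l ltr_pM2l ?ltr0n.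
have lt01 : place p m a ord0 0 ord0 < place p m a ord_max 0 ord0.
  by rewrite !place_first ltrD2l ltr_pM2l ?ltr0n.
rewrite big_mkcond !big_ord_recl big_ord0/= addr0.
rewrite (_ : lift ord0 ord0 = ord_max); last exact/val_inj.
rewrite -!place_first leNgt.
case: ltP => t0 /=; last first.
  by rewrite ltNge (le_trans t0 (ltW lt01))/= addr0.
by case: ltP => _ /=; rewrite !expr0 ?expr1; ring.
Unshelve. all: by end_near. Qed.

Lemma below_empty_slice d (a : 'I_d.+3 -> 'rV[R]_d.+2) t (y : 'rV[R]_d.+1) :
  affinely_independent a ->
  (forall i, a i 0 ord0 < t) \/ (forall i, t < a i 0 ord0) ->
  `[< below (osimp a) (vcons t y) >] = false.
Proof.
move=> aff_a out; apply/asboolP => bx.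
have [e ax] := filter_ex bx; rewrite /= vcons_lower in ax.
case: out => out.
  by have := osimp_first_lt aff_a ax out; rewrite vcons0 ltxx.
by have := osimp_first_gt aff_a ax out; rewrite vcons0 ltxx.
Qed.

Section Step.
Variables (d : nat) (a : 'I_d.+3 -> 'rV[R]_d.+2) (K : 'I_d.+3 -> R).
Hypothesis latt : lattice_position a.
Hypothesis tau_mono : forall i j : 'I_d.+3, (i < j)%N -> a i 0 ord0 < a j 0 ord0.
Hypothesis slopeK : forall i, homogeneous_count (slope a i) (K i).

(** The slices of the cone at vertex i are translated dilations of its simplex of
    slopes, whose points are counted by a multiple of a power of the distance to the
    vertex. *)
Lemma slice_count (p : 'rV[R]_d.+2) m (t : R) : (forall j, p 0 j \is a Num.int) ->
  (0 < m)%N -> t \is a Num.int ->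
  \forall M \near \oo, \sum_(y <- box R M d.+1)
      `[< below (osimp (place p m a)) (vcons t y) >]%:R =
    \sum_(i < d.+3 | p 0 ord0 + m%:R * a i 0 ord0 < t)
      (-1) ^+ i * K i * (t - (p 0 ord0 + m%:R * a i 0 ord0)) ^+ d.+1.
Proof.
move=> pZ m0 tZ; have latt' := lattice_position_place m0 pZ latt.
have H : \forall M \near \oo, forall i, p 0 ord0 + m%:R * a i 0 ord0 < t ->
    box_count M (below (osimp (slice_simplex (place p m a) i t))) =
    (t - (p 0 ord0 + m%:R * a i 0 ord0)) ^+ d.+1 * K i.
  apply: filter_forall => i.
  have [it|it] := ltP (p 0 ord0 + m%:R * a i 0 ord0) t; last exact: filterE.
  have /natrP[n nE] : t - (p 0 ord0 + m%:R * a i 0 ord0) \is a Num.nat.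
    rewrite -intrEge0 ?subr_ge0 ?(ltW it)// rpredB// rpredD// rpredM ?natr_int//.
    exact: lattice_position_int.
  have n0 : (0 < n)%N by rewrite -(@ltr_nat R) -nE subr_gt0.
  have qZ j : tail (place p m a i) 0 j \is a Num.int.
    by rewrite mxE lattice_position_int.
  have := @slopeK i (tail (place p m a i)) n qZ n0; apply: filterS => M HM _.
  rewrite nE -HM; congr (box_count M (below (osimp _))).
  apply/funext => k; rewrite /slice_simplex place_first nE.
  by rewrite place_slope.
apply: filterS H => M HM.
have mono' : forall i j : 'I_d.+3, (i < j)%N ->
    place p m a i 0 ord0 < place p m a j 0 ord0.
  by move=> i j ij; rewrite !place_first ltrD2l ltr_pM2l ?ltr0n// tau_mono.
rewrite (eq_bigr _ (fun y _ => below_slice latt' mono' y tZ)) exchange_big/=.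
apply: eq_big => [i|i]; rewrite place_first// => it.
by rewrite -mulr_sumr -mulrA [K i * _]mulrC -(HM i it).
Qed.

Lemma slice_sum_vanishes (p : 'rV[R]_d.+2) m (t : R) :
  (forall j, p 0 j \is a Num.int) -> (0 < m)%N -> t \is a Num.int ->
  (forall i, p 0 ord0 + m%:R * a i 0 ord0 < t) ->
  \sum_(i < d.+3) (-1) ^+ i * K i * (t - (p 0 ord0 + m%:R * a i 0 ord0)) ^+ d.+1 = 0.
Proof.
move=> pZ m0 tZ at_; have latt' := lattice_position_place m0 pZ latt.
have [M] := filter_ex (slice_count pZ m0 tZ).
rewrite big1 => [E|y _]; first by rewrite [RHS]E; apply: eq_bigl => i; rewrite at_.
rewrite (below_empty_slice _ latt'.1)//.
by left => i; rewrite place_first.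
Qed.

(** The numbers of points of the slices are the values at the integers of a spline
    with integer knots. *)
Lemma homogeneous_count_step : exists K0, homogeneous_count a K0.
Proof.
have [|t tZ tt|K0 HK] := @truncated_power_sum R d.+3 (fun i => (-1) ^+ i * K i)
  (fun i => a i 0 ord0) d.+1.
- by move=> i; exact: lattice_position_int.
- have := @slice_sum_vanishes 0 1%N t; rewrite mxE => /(_ _ isT tZ).
  under eq_bigr do rewrite add0r mul1r.
  by apply => [j|i]; rewrite ?mxE ?add0r ?mul1r.
exists K0 => p m pZ m0.
pose tau' i := p 0 ord0 + m%:R * a i 0 ord0.
have pm := lattice_position_place m0 pZ latt.
have [M0 HM0] := bound_nat tau'.
have H : \forall M \near \oo, forall i : 'I_(M0.*2.+1),
    \sum_(y <- box R M d.+1)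
      `[< below (osimp (place p m a)) (vcons (i%:R - M0%:R) y) >]%:R =
    \sum_(j < d.+3 | tau' j < i%:R - M0%:R) (-1) ^+ j * K j * (i%:R - M0%:R - tau' j) ^+ d.+1.
  by apply: filter_forall => i; apply: slice_count => //; rewrite rpredB ?natr_int.
near=> M; have M0M : M0%:R <= M%:R :> R by rewrite ler_nat; near: M; exact: nbhs_infty_ge.
have HM : forall i : 'I_(M0.*2.+1),
    \sum_(y <- box R M d.+1)
      `[< below (osimp (place p m a)) (vcons (i%:R - M0%:R) y) >]%:R =
    \sum_(j < d.+3 | tau' j < i%:R - M0%:R) (-1) ^+ j * K j * (i%:R - M0%:R - tau' j) ^+ d.+1.
  by near: M.
rewrite box_countS -(HK (p 0 ord0) m M) ?pZ//; last first.
  by move=> i; rewrite -ler_norml (le_trans (HM0 i)).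
apply: eq_big_seq => t; rewrite mem_ints => /andP[tZ tM].
(* Outside the range of the first coordinates both sides vanish. *)
have [tM0|] := leP `|t| M0%:R.
  have : t \in ints R M0 by rewrite mem_ints tZ.
  move=> /mapP[i]; rewrite mem_index_iota /= => iM0 ->.
  exact: HM (Ordinal iM0).
have range i : - M0%:R <= tau' i <= M0%:R by rewrite -ler_norml.
rewrite ltr_normr => /orP[tgt|tlt]; rewrite big1; first last.
- move=> y _; rewrite (below_empty_slice _ pm.1)//; right => i.
  by rewrite place_first -/(tau' i); have /andP[] := range i; lra.
- rewrite big1// => i; rewrite -/(tau' i) => ti; have /andP[] := range i; lra.
- move=> y _; rewrite (below_empty_slice _ pm.1)//; left => i.
  by rewrite place_first -/(tau' i); have /andP[] := range i; lra.
have tau_t i : tau' i < t by have /andP[] := range i; lra.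
rewrite -[LHS](slice_sum_vanishes pZ m0 tZ tau_t).
by apply: eq_bigl => i; rewrite tau_t.
Unshelve. all: by end_near. Qed.
End Step.

(** Induction on the dimension through slices; reindexing makes the first coordinates
    of the vertices increasing. *)
Theorem homogeneous_count_simplex d (a : 'I_d.+2 -> 'rV[R]_d.+1) :
  lattice_position a -> exists K, homogeneous_count a K.
Proof.
have reindex_count d' (b : 'I_d'.+2 -> 'rV[R]_d'.+1) (f : 'I_d'.+2 -> 'I_d'.+2) :
    injective f -> lattice_position b ->
    (exists K, homogeneous_count (b \o f) K) -> exists K, homogeneous_count b K.
  move=> f_inj lb [K HK]; exists K => p m pZ m0; have := HK p m pZ m0.
  have -> : place p m (b \o f) = place p m b \o f by [].
  by rewrite osimp_reindex//; case: (lattice_position_place m0 pZ lb).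
elim: d a => [|d IH] a latt.
  have [|f f_inj f_mono] := @sorting_reindex _ _ (fun i => a i 0 ord0).
    by move=> i j; exact: lattice_position_first_inj.
  apply: (reindex_count _ a f f_inj latt).
  apply: homogeneous_count_interval; first exact: lattice_position_reindex.
  exact: f_mono.
have [|f f_inj f_mono] := @sorting_reindex _ _ (fun i => a i 0 ord0).
  by move=> i j; exact: lattice_position_first_inj.
apply: (reindex_count _ a f f_inj latt).
have lf := lattice_position_reindex f_inj latt.
have [K HK] : exists K : 'I_d.+3 -> R, forall i, homogeneous_count (slope (a \o f) i) (K i).
  apply: (@fin_all_exists _ (fun=> R) (fun i K => homogeneous_count (slope (a \o f) i) K)).
  by move=> i; apply: IH; exact: lattice_position_slope.
exact: (homogeneous_count_step lf f_mono HK).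
Qed.
End Homogeneity.

(** * Dissections into simplices in lattice position *)

Section Dissections.
Variable R : realType.

Definition convex_closed d (P : set 'rV[R]_d) : Prop :=
  forall x y t, P x -> P y -> 0 <= t <= 1 -> P ((1 - t) *: x + t *: y).

Lemma drop_last_lower d (x : 'rV[R]_d.+1) s : drop_last (x - s *: elast R d) = drop_last x.
Proof.
apply/rowP => j; rewrite !mxE.
have -> : (widen_ord (leqnSn d) j == ord_max) = false by rewrite -val_eqE/= ltn_eqF.
by rewrite andbF mulr0 subr0.
Qed.

Lemma last_coord_lower d (x : 'rV[R]_d.+1) s :
  last_coord (x - s *: elast R d) = last_coord x - s.
Proof. by rewrite /last_coord !mxE !eqxx mulr1. Qed.

Lemma row_last_eq d (x y : 'rV[R]_d.+1) :
  drop_last x = drop_last y -> last_coord x = last_coord y -> x = y.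
Proof.
move=> xy lxy; apply/rowP => j; case: (unliftP ord_max j) => [k|] -> //.
have := congr1 (fun v : 'rV[R]_d => v 0 k) xy; rewrite !mxE.
by congr (x 0 _ = y 0 _); apply/val_inj; rewrite /= /bump leqNgt ltn_ord.
Qed.

Lemma same_fiber d (x y : 'rV[R]_d.+1) :
  drop_last x = drop_last y -> y = x - (last_coord x - last_coord y) *: elast R d.
Proof.
move=> xy; apply: row_last_eq; first by rewrite drop_last_lower.
by rewrite last_coord_lower opprB addrC subrK.
Qed.

(** If a point of P is not the lowest of its fiber, convexity puts a whole segment
    below it into P. *)
Lemma Omega_below d (P : set 'rV[R]_d.+1) :
  convex_closed P -> below P `<=` P -> Omega P = below P.
Proof.
move=> convP closedP; apply/seteqP; split => [x [Px nNB]|x bx].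
  have [z [Pz zx zlt]] : exists z, [/\ P z, drop_last x = drop_last z &
      last_coord z < last_coord x].
    apply: contrapT => /forallNP nz; apply: nNB; exists (drop_last x); first by exists x.
    split=> // z [zx Pz]; rewrite leNgt; apply/negP => zlt.
    by apply: (nz z); split.
  set s := last_coord x - last_coord z; have s0 : 0 < s by rewrite subr_gt0.
  near=> e.
  have -> : x - e *: elast R d = (1 - e / s) *: x + (e / s) *: z.
    rewrite (same_fiber zx) -/s scalerBr addrA -scalerDl subrK scale1r scalerA divfK//.
    by rewrite gt_eqF.
  apply: convP => //; apply/andP; split.
    by rewrite divr_ge0 ?(ltW s0)// ltW//; near: e; exact: nbhs_right_gt.
  rewrite ler_pdivrMr// mul1r ltW//; near: e; exact: nbhs_right_lt.
split; first exact: closedP.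
move=> [y _ [[xy Px] low]].
have e0 : \forall e \near 0^'+, 0 < e :> R by exact: nbhs_right_gt.
have [e [Pe ep]] := filter_ex (@filterI _ _ _ _ _ bx e0).
have /low : fiber y P (x - e *: elast R d) by split => //=; rewrite drop_last_lower.
by rewrite last_coord_lower; lra.
Unshelve. all: by end_near. Qed.

Lemma simp_convex d (a : 'I_d.+1 -> 'rV[R]_d) :
  affinely_independent a -> convex_closed (simp a).
Proof.
move=> aff_a x y t ax ay /andP[t0 t1] i.
have -> : bar a 1 ((1 - t) *: x + t *: y) i =
    (1 - t) * bar a 1 x i + t * bar a 1 y i.
  by rewrite -!barZ// -barD// !mulr1 subrK.
by rewrite addr_ge0 ?mulr_ge0 ?subr_ge0.
Qed.

Lemma simp_conv d (a : 'I_d.+1 -> 'rV[R]_d) :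
  affinely_independent a -> simp a = Defs.conv (range a).
Proof.
move=> aff_a; apply/seteqP; split=> x.
  move=> ax; exists d.+1, (bar a 1 x), a; split=> //.
  - exact: bar_sum.
  - by rewrite bar_comb.
move=> [m [w [p [w0 w1 pa ->]]]].
have [f fE] : exists f : 'I_m -> 'I_d.+1, forall i, a (f i) = p i.
  by apply: (@fin_all_exists _ (fun=> 'I_d.+1) (fun i j => a j = p i)) => i;
    have [j _ <-] := pa i; exists j.
move=> j; rewrite (bar_eq aff_a (w := fun j => \sum_(i | f i == j) w i)).
- by rewrite sumr_ge0.
- rewrite -[RHS]w1 (exchange_big_dep xpredT)//=.
  by apply: eq_bigr => i _; rewrite (big_pred1 (f i))// => k; rewrite eq_sym.
- under eq_bigr do rewrite scaler_suml.
  rewrite (exchange_big_dep xpredT)//=.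
  by apply: eq_bigr => i _; rewrite (big_pred1 (f i)) ?fE// => k; rewrite eq_sym.
Qed.

Lemma below_simp_sub d (a : 'I_d.+2 -> 'rV[R]_d.+1) :
  affinely_independent a -> below (simp a) `<=` simp a.
Proof.
move=> aff_a x bx i; rewrite leNgt; apply/negP => xi.
have := near0_pos (p := - bar a 1 x i) (bar a 0 (elast R d) i).
rewrite oppr_gt0 => /(_ xi) h.
have [e [/(_ i)]] := filter_ex (@filterI _ _ _ _ _ bx h).
by rewrite bar_lower//; lra.
Qed.

Lemma Omega_simp d (a : 'I_d.+2 -> 'rV[R]_d.+1) : lattice_position a ->
  Omega (simp a) = below (osimp a).
Proof.
move=> latt; have [aff_a _] := latt.
by rewrite (Omega_below (simp_convex aff_a) (below_simp_sub aff_a)) below_simpE.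
Qed.

Lemma near_below_simp d (a : 'I_d.+2 -> 'rV[R]_d.+1) x : lattice_position a ->
  \forall e \near 0^'+, simp a (x - e *: elast R d) <-> below (osimp a) x.
Proof.
move=> latt; case: (below_simp_dichotomy x latt) => bx; near=> e.
  by split=> // _; apply: osimp_simp; near: e.
have nx : ~ simp a (x - e *: elast R d) by near: e.
split=> [//|bx'].
by have [e' [/osimp_simp]] := filter_ex (@filterI _ _ _ _ _ bx' bx).
Unshelve. all: by end_near. Qed.

(** A triangulation in a form that is stable under projection: overlaps are excluded
    through the open simplices. *)
Record lattice_dissection d (J : finType) (a : J -> 'I_d.+2 -> 'rV[R]_d.+1)
    (P : set 'rV[R]_d.+1) : Prop := LatticeDissection {
  dissection_convex : convex_closed P;
  dissection_cover : P = \bigcup_j simp (a j);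
  dissection_position : forall j, lattice_position (a j);
  dissection_disjoint : forall i j x, osimp (a i) x -> osimp (a j) x -> i = j;
  dissection_nonempty : exists j : J, True }.

Section Dissection.
Variables (d : nat) (J : finType) (a : J -> 'I_d.+2 -> 'rV[R]_d.+1).
Variable P : set 'rV[R]_d.+1.
Hypothesis dis : lattice_dissection a P.

Let latt := dissection_position dis.

Lemma dissection_sub j : simp (a j) `<=` P.
Proof. by rewrite (dissection_cover dis) => x ax; exists j. Qed.

Lemma dissection_in x : P x -> exists j, simp (a j) x.
Proof. by rewrite (dissection_cover dis) => -[j _ ax]; exists j. Qed.

Lemma below_dissection x : below P x <-> exists j, below (osimp (a j)) x.
Proof.
split=> [bx|[j]]; last first.
  by apply: filterS => e /osimp_simp; exact: dissection_sub.
have h : \forall e \near 0^'+, forall j,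
    simp (a j) (x - e *: elast R d) <-> below (osimp (a j)) x.
  by apply: filter_forall => j; exact: near_below_simp.
have [e [/dissection_in[j aj] he]] := filter_ex (@filterI _ _ _ _ _ bx h).
by exists j; apply/(he j).
Qed.

Lemma below_disjoint i j x : below (osimp (a i)) x -> below (osimp (a j)) x -> i = j.
Proof.
move=> bi bj; have [e [ai aj]] := filter_ex (@filterI _ _ _ _ _ bi bj).
exact: dissection_disjoint dis _ _ _ ai aj.
Qed.

Lemma below_dissection_sub : below P `<=` P.
Proof.
move=> x /below_dissection[j]; rewrite -below_simpE// => /(below_simp_sub (latt j).1).
exact: dissection_sub.
Qed.

Lemma Omega_dissection : Omega P = below P.
Proof.
by apply: Omega_below; [exact: dissection_convex dis|exact: below_dissection_sub].
Qed.

(** A slightly lowered point lies on no facet hyperplane, so it is in the interior of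
    exactly one simplex, or outside all of them. *)
Lemma below_indicator (T : pzSemiRingType) x :
  (`[< below P x >])%:R = \sum_j (`[< below (osimp (a j)) x >])%:R :> T.
Proof.
have [bx|bx] := pselect (below P x).
  have [j bj] := (below_dissection x).1 bx.
  rewrite (bigD1 j)//= big1 ?addr0 => [|i ij]; first by rewrite !asboolT.
  by rewrite asboolF// => bi; move/eqP: ij; apply; exact: below_disjoint bi bj.
rewrite asboolF// big1// => j _; rewrite asboolF// => bj.
by apply: bx; apply/below_dissection; exists j.
Qed.

End Dissection.

Lemma bar_place d (p : 'rV[R]_d) m (a : 'I_d.+1 -> 'rV[R]_d) x i :
  affinely_independent a -> affinely_independent (place p m a) ->
  bar (place p m a) 1 (p + m%:R *: x) i = bar a 1 x i.
Proof.
move=> aff_a aff_b; apply: (bar_eq aff_b); first exact: bar_sum.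
under eq_bigr do rewrite scalerDr scalerA mulrC -scalerA.
by rewrite big_split/= -scaler_suml bar_sum// scale1r -scaler_sumr bar_comb.
Qed.

Lemma dissection_dilate d (J : finType) (a : J -> 'I_d.+2 -> 'rV[R]_d.+1) P m :
  (0 < m)%N -> lattice_dissection a P ->
  lattice_dissection (fun j => place 0 m (a j)) (dilate m P).
Proof.
move=> m0 dis; have mn0 : m%:R != 0 :> R by rewrite pnatr_eq0 -lt0n.
have latt' j : lattice_position (place 0 m (a j)).
  apply: lattice_position_place => // [i|]; first by rewrite mxE.
  exact: dissection_position dis j.
have barE j x i : bar (place 0 m (a j)) 1 (m%:R *: x) i = bar (a j) 1 x i.
  rewrite -[m%:R *: x]add0r bar_place//; last exact: (latt' j).1.
  exact: (dissection_position dis j).1.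
split => //.
- move=> _ _ t [x Px <-] [y Py <-] t01; exists ((1 - t) *: x + t *: y).
    exact: dissection_convex dis _ _ _ Px Py t01.
  by rewrite scalerDr !scalerA mulrC [m%:R * t]mulrC.
- apply/seteqP; split => [_ [x Px <-]|x [j _ ax]].
    have [j ax] := dissection_in dis Px; exists j => // i; rewrite barE; exact: ax.
  exists (m%:R^-1 *: x); last by rewrite scalerA divff// scale1r.
  apply: (dissection_sub dis (j := j)) => i.
  by rewrite -barE scalerA divff// scale1r; exact: ax.
- move=> i j x ai aj; apply: (dissection_disjoint dis (x := m%:R^-1 *: x)) => k.
    by rewrite -barE scalerA divff// scale1r; exact: ai.
  by rewrite -barE scalerA divff// scale1r; exact: aj.
- exact: dissection_nonempty dis.
Qed.

Lemma dissection_count d (J : finType) (a : J -> 'I_d.+2 -> 'rV[R]_d.+1) P :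
  lattice_dissection a P -> exists D, forall m, (0 < m)%N ->
    \forall M \near \oo, box_count M (below (dilate m P)) = m%:R ^+ d.+1 * D.
Proof.
move=> dis; have [K HK] : exists K : J -> R, forall j, homogeneous_count (a j) (K j).
  apply: (@fin_all_exists _ (fun=> R) (fun j K => homogeneous_count (a j) K)) => j.
  exact/homogeneous_count_simplex/(dissection_position dis j).
exists (\sum_j K j) => m m0; have dism := dissection_dilate m0 dis.
have h : \forall M \near \oo, forall j,
    box_count M (below (osimp (place 0 m (a j)))) = m%:R ^+ d.+1 * K j.
  by apply: filter_forall => j; apply: HK => // i; rewrite mxE.
apply: filterS h => M hM; rewrite /box_count.
under eq_bigr do rewrite (below_indicator dism).
by rewrite exchange_big/= mulr_sumr; apply: eq_bigr => j _; exact: hM.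
Qed.

End Dissections.

(** * Lowest points of fibers *)

Section Projection.
Variable R : realType.

Lemma drop_lastD d (x y : 'rV[R]_d.+1) : drop_last (x + y) = drop_last x + drop_last y.
Proof. by apply/rowP => j; rewrite !mxE. Qed.

Lemma drop_lastZ d k (x : 'rV[R]_d.+1) : drop_last (k *: x) = k *: drop_last x.
Proof. by apply/rowP => j; rewrite !mxE. Qed.

Lemma drop_last_sum d n (w : 'I_n -> R) (p : 'I_n -> 'rV[R]_d.+1) :
  drop_last (\sum_i w i *: p i) = \sum_i w i *: drop_last (p i).
Proof.
by apply/rowP => j; rewrite !mxE !summxE; apply: eq_bigr => i _; rewrite !mxE.
Qed.

Lemma bar_facet d (a : 'I_d.+2 -> 'rV[R]_d.+1) k l x : lattice_position a ->
  bar a 1 x k = 0 -> bar (facet a k) 1 (drop_last x) l = bar a 1 x (lift k l).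
Proof.
move=> latt xk; have [aff_a _] := latt.
apply: (bar_eq (lattice_position_facet k latt).1 (w := fun l => bar a 1 x (lift k l))).
  by rewrite -[RHS](bar_sum aff_a 1 x) [RHS](bigD1_ord k)//= xk add0r.
rewrite -[in RHS](bar_comb aff_a 1 x) drop_last_sum [RHS](bigD1_ord k)//= xk.
by rewrite scale0r add0r.
Qed.

(** The point over y of the hyperplane spanned by the facet opposite to vertex k. *)
Definition facet_lift d (a : 'I_d.+2 -> 'rV[R]_d.+1) k (y : 'rV[R]_d) : 'rV[R]_d.+1 :=
  \sum_l bar (facet a k) 1 y l *: a (lift k l).

Lemma facet_liftP d (a : 'I_d.+2 -> 'rV[R]_d.+1) k y : lattice_position a ->
  drop_last (facet_lift a k y) = y /\ bar a 1 (facet_lift a k y) k = 0.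
Proof.
move=> latt; have [aff_a _] := latt; have [aff_f _] := lattice_position_facet k latt.
split; first by rewrite drop_last_sum -[RHS](bar_comb aff_f 1 y).
rewrite (bar_eq aff_a (w := fun i => oapp (bar (facet a k) 1 y) 0 (unlift k i))).
- by rewrite unlift_none.
- rewrite (bigD1_ord k)//= unlift_none add0r -[RHS](bar_sum aff_f 1 y).
  by apply: eq_bigr => l _; rewrite liftK.
- by rewrite sum_lift_extend.
Qed.

Lemma facet_lift_bar d (a : 'I_d.+2 -> 'rV[R]_d.+1) k y l : lattice_position a ->
  bar a 1 (facet_lift a k y) (lift k l) = bar (facet a k) 1 y l.
Proof.
move=> latt; have [yE k0] := facet_liftP k y latt.
by rewrite -[in RHS]yE bar_facet.
Qed.

Lemma facet_lift_simp d (a : 'I_d.+2 -> 'rV[R]_d.+1) k y : lattice_position a ->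
  simp (facet a k) y -> simp a (facet_lift a k y).
Proof.
move=> latt yin i; case: (unliftP k i) => [l|] ->; first by rewrite facet_lift_bar.
by rewrite (facet_liftP k y latt).2.
Qed.

(** Moving down inside a simplex ends on a lower facet. *)
Lemma simp_descend d (a : 'I_d.+2 -> 'rV[R]_d.+1) x : lattice_position a -> simp a x ->
  exists k s, [/\ 0 <= s, 0 < bar a 0 (elast R d) k,
    bar a 1 (x - s *: elast R d) k = 0 & simp a (x - s *: elast R d)].
Proof.
move=> latt ax; have [aff_a _] := latt; set v := bar a 0 (elast R d).
have [k0 vk0] : exists k0, 0 < v k0.
  apply: contrapT => /forallNP vN.
  have vs : \sum_i - v i = 0 by rewrite sumrN bar_sum// oppr0.
  have vp i : true -> 0 <= - v i by move=> _; rewrite oppr_ge0 leNgt; apply/negP.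
  have /eqP := psumr_eq0P vp vs (i := ord0) isT.
  by rewrite oppr_eq0 (negPf (bar_last_neq0 ord0 latt)).
case: (@Order.TotalTheory.arg_minP _ _ _ k0 (fun k => 0 < v k) (fun k => bar a 1 x k / v k) vk0)
  => k vk kmin.
exists k, (bar a 1 x k / v k); split => //.
- by rewrite divr_ge0// ltW.
- by rewrite bar_lower// -/v divfK ?subrr// gt_eqF.
- move=> i; rewrite bar_lower// -/(v i) subr_ge0.
  have [vi|vi] := ltP 0 (v i); first by rewrite -ler_pdivlMr// kmin.
  by rewrite (le_trans _ (ax i))// mulr_ge0_le0// divr_ge0// ltW.
Qed.

Section Lowest.
Variables (d : nat) (J : finType) (a : J -> 'I_d.+2 -> 'rV[R]_d.+1).
Variable P : set 'rV[R]_d.+1.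
Hypothesis dis : lattice_dissection a P.

Let latt := dissection_position dis.

(** Only finitely many points of a fiber lie on the hyperplane of a lower facet of some
    simplex, and descending shows that one of them is lowest. *)
Lemma exists_lowest z : P z -> exists n j k,
  [/\ is_lowest (drop_last z) P n, simp (a j) n, 0 < bar (a j) 0 (elast R d) k &
      bar (a j) 1 n k = 0].
Proof.
move=> Pz; pose v j := bar (a j) 0 (elast R d).
pose s b := bar (a b.1) 1 z b.2 / v b.1 b.2.
pose c b := z - s b *: elast R d.
pose good b := (0 < v b.1 b.2) && `[< simp (a b.1) (c b) >].
have down x : P x -> drop_last x = drop_last z ->
    exists2 b, good b & last_coord (c b) <= last_coord x.
  move=> Px xz; have [j ax] := dissection_in dis Px.
  have [k [e [e0 vk xk ax']]] := simp_descend (latt j) ax.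
  have cE : c (j, k) = x - e *: elast R d.
    have xe : drop_last z = drop_last (x - e *: elast R d) by rewrite drop_last_lower.
    rewrite [RHS](same_fiber xe) /c; congr (_ - _ *: _).
    move: xk; rewrite {1}(same_fiber xe) bar_lower//; last exact: (latt j).1.
    move=> /eqP; rewrite subr_eq0 => /eqP zk.
    by rewrite /s /= zk -/(v j k) mulfK// gt_eqF.
  exists (j, k); first by rewrite /good /= vk cE; exact/asboolP.
  by rewrite cE last_coord_lower gerBl.
have [b0 gb0 _] := down z Pz erefl.
case: (@Order.TotalTheory.arg_minP _ _ _ b0 good (fun b => last_coord (c b)) gb0) => b /andP[vb /asboolP ab] bmin.
exists (c b), b.1, b.2; split => //.
  split; first by split; [exact: drop_last_lower|exact: dissection_sub ab].
  move=> x [xz Px]; have [b' gb' b'x] := down x Px xz.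
  exact: le_trans (bmin _ gb') b'x.
rewrite bar_lower; last exact: (latt _).1.
by rewrite -/(v _ _) /s divfK ?subrr// gt_eqF.
Qed.

(** A point of the relative interior of a lower facet is lowest in its fiber only if
    the hyperplane of the facet supports P, since otherwise the point could be moved
    down along a segment towards a point of P below the hyperplane. *)
Lemma lowest_supporting n j k : is_lowest (drop_last n) P n ->
  0 < bar (a j) 0 (elast R d) k -> bar (a j) 1 n k = 0 ->
  (forall i, i != k -> 0 < bar (a j) 1 n i) ->
  forall x, P x -> 0 <= bar (a j) 1 x k.
Proof.
move=> [[_ Pn] low] vk nk nl x Px; rewrite leNgt; apply/negP => xk.
have [aff_a _] := latt j.
set v := bar (a j) 0 (elast R d) in vk.
(* With this height u still points to the positive side of the facet hyperplane. *)
pose h := - bar (a j) 1 x k / (2 * v k).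
have h0 : 0 < h by rewrite divr_gt0 ?oppr_gt0 ?mulr_gt0.
pose u := n - x - h *: elast R d.
have uE i : bar (a j) 0 u i = bar (a j) 1 n i - bar (a j) 1 x i - h * v i.
  have -> : u = n + (-1) *: x + (- h) *: elast R d by rewrite scaleN1r scaleNr.
  rewrite /v (_ : bar (a j) 0 _ i =
    bar (a j) (1 + (-1) * 1 + (- h) * 0) (n + (-1) *: x + (- h) *: elast R d) i).
    by rewrite !barD// !barZ// mulN1r mulNr.
  by congr (bar _ _ _ _); ring.
have : \forall e \near 0^'+, forall i, 0 < bar (a j) 1 (n + e *: u) i.
  apply: filter_forall => i.
  have [->|ik] := eqVneq i k; last first.
    by have := near0_pos (bar (a j) 0 u i) (nl i ik); apply: filterS => e; rewrite bar_move.
  have uk : 0 < bar (a j) 0 u k.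
    rewrite uE nk /h invfM mulrA mulfVK ?gt_eqF//; lra.
  have e0 : \forall e \near 0^'+, 0 < e :> R by exact: nbhs_right_gt.
  by apply: filterS e0 => e e0; rewrite bar_move// nk add0r mulr_gt0.
have e0 : \forall e \near 0^'+, 0 < e :> R by exact: nbhs_right_gt.
move=> au0; have [e [au ep]] := filter_ex (@filterI _ _ _ _ _ au0 e0).
have {}ep : 0 < e := ep.
have Pu : P (n + e *: u) by apply: (dissection_sub dis (j := j)) => i; exact: ltW.
have e1p : 0 < 1 + e by rewrite ltr_pwDl// ltW.
have e1 : 1 + e != 0 by rewrite gt_eqF.
have mE : (1 - e / (1 + e)) *: (n + e *: u) + (e / (1 + e)) *: x =
    n - (e * h / (1 + e)) *: elast R d.
  apply/rowP => i; rewrite !mxE; move: (_ && _) => b; field; exact: e1.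
have Pm : P (n - (e * h / (1 + e)) *: elast R d).
  rewrite -mE; apply: (dissection_convex dis) => //; apply/andP; split.
    by rewrite divr_ge0 ?ltW.
  by rewrite ler_pdivrMr ?mul1r ?lerDr.
have : last_coord n <= last_coord (n - (e * h / (1 + e)) *: elast R d).
  by apply: low; split => //=; rewrite drop_last_lower.
have s0 : 0 < e * h / (1 + e) := divr_gt0 (mulr_gt0 ep h0) e1p.
by rewrite last_coord_lower lerBrDr gerDl leNgt s0.
Qed.

End Lowest.
End Projection.

(** * Projection of a dissection *)

Section ProjectedDissection.
Variable R : realType.
Variables (d : nat) (J : finType) (a : J -> 'I_d.+3 -> 'rV[R]_d.+2).
Variable P : set 'rV[R]_d.+2.
Hypothesis dis : lattice_dissection a P.

Let latt := dissection_position dis.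

(** The facet of the simplex b.1 opposite to its vertex b.2 is a lower facet whose
    hyperplane supports P, so it is a piece of the negative boundary of P. *)
Definition lower_facet (b : J * 'I_d.+3) : bool :=
  (0 < bar (a b.1) 0 (elast R d.+1) b.2) &&
  `[< forall x, P x -> 0 <= bar (a b.1) 1 x b.2 >].

Definition lower_facets := {b : J * 'I_d.+3 | lower_facet b}.

Definition projected_facet (b : lower_facets) : 'I_d.+2 -> 'rV[R]_d.+1 :=
  facet (a (val b).1) (val b).2.

(** When y avoids the projections of the hyperplanes that bound facets, the lowest
    point of P over y is in the relative interior of a facet of some simplex, and such
    a facet supports P. *)
Lemma lower_facet_through y : (@drop_last R d.+1 @` P) y ->
  (forall j k l, bar (facet (a j) k) 1 y l != 0) ->
  exists b, osimp (projected_facet b) y.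
Proof.
move=> [z Pz zy] gen; have [n [j [k [low an vk nk]]]] := exists_lowest dis Pz.
have nz : drop_last n = drop_last z by case: low => -[].
have pos l : 0 < bar (a j) 1 n (lift k l).
  rewrite lt0r an andbT -(bar_facet l (latt j) nk) nz zy; exact: gen.
have pos' i : i != k -> 0 < bar (a j) 1 n i.
  by case: (unliftP k i) => [l ->|->]; rewrite ?eqxx.
have lowF : lower_facet (j, k).
  rewrite /lower_facet /= vk; apply/asboolP.
  by apply: (lowest_supporting dis _ vk nk pos'); rewrite nz.
exists (exist _ (j, k) lowF) => l.
by rewrite /projected_facet/= -zy -nz bar_facet.
Qed.

Lemma projected_simp_sub b : simp (projected_facet b) `<=` @drop_last R d.+1 @` P.
Proof.
move=> y yin; exists (facet_lift (a (val b).1) (val b).2 y).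
  by apply: (dissection_sub dis (j := (val b).1)); apply: facet_lift_simp.
by have [] := facet_liftP (val b).2 y (latt (val b).1).
Qed.

(** Points near y are generic after being moved towards the projection of an interior
    point and then lowered, so they lie in projected lower facets. There are finitely
    many of these and they are closed, so one of them contains y. *)
Lemma projected_cover : @drop_last R d.+1 @` P = \bigcup_b simp (projected_facet b).
Proof.
apply/seteqP; split=> [y Qy|y [b _]]; last exact: projected_simp_sub.
apply: contrapT => ny.
have out b : exists l, bar (projected_facet b) 1 y l < 0.
  apply: contrapT => /forallNP nl; apply: ny; exists b => // l.
  by rewrite leNgt; apply/negP.
have [j0 _] := dissection_nonempty dis.
pose C : 'rV[R]_d.+2 := \sum_i (d.+3)%:R^-1 *: a j0 i.
have barC i : bar (a j0) 1 C i = (d.+3)%:R^-1.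
  rewrite (bar_eq (latt j0).1 (w := fun=> (d.+3)%:R^-1))//.
  by rewrite sumr_const card_ord -[LHS]mulr_natl mulfV// pnatr_eq0.
pose u : 'rV[R]_d.+2 := \row_j (widen_ord (leqnSn d.+1) ord_max == j)%:R.
have uE : drop_last u = elast R d.
  apply/rowP => j; rewrite !mxE eqxx/= eq_sym; congr (_%:R); congr nat_of_bool.
have affF b : affinely_independent (projected_facet b).
  exact: (lattice_position_facet _ (latt _)).1.
(* Move y a little towards the projection of the centroid of a simplex. *)
have [s [s0 s1 outs]] : exists s, [/\ 0 < s, s <= 1 & forall b, exists l,
    bar (projected_facet b) 1 (y + s *: (drop_last C - y)) l < 0].
  have h : \forall s \near 0^'+, forall b, exists l,
      bar (projected_facet b) 1 (y + s *: (drop_last C - y)) l < 0.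
    apply: filter_forall => b; have [l yl] := out b.
    have := near0_pos (p := - bar (projected_facet b) 1 y l)
      (- bar (projected_facet b) 0 (drop_last C - y) l).
    rewrite oppr_gt0 => /(_ yl); apply: filterS => s sp; exists l.
    by rewrite bar_move; [lra|exact: affF].
  have h0 : \forall s \near 0^'+, 0 < s :> R by exact: nbhs_right_gt.
  have h1 : \forall s \near 0^'+, s <= 1 :> R by apply: nbhs_right_le.
  have [s [hs [s0 s1]]] := filter_ex (@filterI _ _ _ _ _ h (@filterI _ _ _ _ _ h0 h1)).
  by exists s.
set ys := y + s *: (drop_last C - y) in outs.
have inQ : \forall e \near 0^'+, (@drop_last R d.+1 @` P) (ys - e *: elast R d).
  have [z Pz zy] := Qy.
  have : \forall e \near 0^'+, forall i,
      0 < bar (a j0) 1 (C + e *: (- s^-1 *: u)) i.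
    apply: filter_forall => i.
    have ci : 0 < bar (a j0) 1 C i by rewrite barC invr_gt0 ltr0n.
    have := near0_pos (bar (a j0) 0 (- s^-1 *: u) i) ci.
    by apply: filterS => e; rewrite bar_move//; exact: (latt j0).1.
  apply: filterS => e ce.
  exists ((1 - s) *: z + s *: (C + e *: (- s^-1 *: u))).
    apply: (dissection_convex dis) => //; last by rewrite ltW.
    by apply: (dissection_sub dis (j := j0)) => i; exact: ltW.
  rewrite drop_lastD !drop_lastZ drop_lastD !drop_lastZ uE zy /ys.
  apply/rowP => i; rewrite !mxE; move: (_ && _) => c; field.
  by rewrite gt_eqF.
have gen : \forall e \near 0^'+, forall j k l,
    bar (facet (a j) k) 1 (ys - e *: elast R d) l != 0.
  apply: filter_forall => j; apply: filter_forall => k.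
  exact/near_bar_neq0/lattice_position_facet.
have outn : \forall e \near 0^'+, forall b, exists l,
    bar (projected_facet b) 1 (ys - e *: elast R d) l < 0.
  apply: filter_forall => b; have [l yl] := outs b.
  have := near0_pos (p := - bar (projected_facet b) 1 ys l)
    (bar (projected_facet b) 0 (elast R d) l).
  rewrite oppr_gt0 => /(_ yl); apply: filterS => e ep; exists l.
  by rewrite bar_lower; [lra|exact: affF].
have [e [Qe [ge oe]]] :=
  filter_ex (@filterI _ _ _ _ _ inQ (@filterI _ _ _ _ _ gen outn)).
have [b be] := lower_facet_through Qe ge.
by have [l] := oe b; rewrite ltNge ltW.
Qed.

(** Both facets contain the lowest point of P over y, and a point slightly above it is
    interior to both simplices. *)
Lemma projected_disjoint b b' y :
  osimp (projected_facet b) y -> osimp (projected_facet b') y -> b = b'.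
Proof.
case: b b' => -[j k] lb [[j' k'] lb'] /= yb yb'.
have /andP[/= vk /asboolP/= supk] := lb; have /andP[/= vk' /asboolP/= supk'] := lb'.
pose p := facet_lift (a j) k y; pose p' := facet_lift (a j') k' y.
have [py pk] := facet_liftP k y (latt j).
have [py' pk'] := facet_liftP k' y (latt j').
have Pp : P p.
  by apply: (dissection_sub dis (j := j)); apply: facet_lift_simp => //; exact: osimp_simp.
have Pp' : P p'.
  by apply: (dissection_sub dis (j := j')); apply: facet_lift_simp => //; exact: osimp_simp.
have pp' : p = p'.
  have E : drop_last p = drop_last p' by rewrite py py'.
  apply: row_last_eq => //; apply/eqP; rewrite eq_le; apply/andP; split.
    have := supk _ Pp'; rewrite {1}(same_fiber E) bar_lower; last exact: (latt j).1.
    by rewrite pk sub0r oppr_ge0 pmulr_lle0// subr_le0.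
  have := supk' _ Pp; rewrite {1}(same_fiber (esym E)) bar_lower; last exact: (latt j').1.
  by rewrite pk' sub0r oppr_ge0 pmulr_lle0// subr_le0.
have up i c : osimp (facet (a i) c) y -> 0 < bar (a i) 0 (elast R d.+1) c ->
    \forall e \near 0^'+, osimp (a i) (facet_lift (a i) c y + e *: elast R d.+1).
  move=> yc vc; apply: filter_forall => l; have [_ lc] := facet_liftP c y (latt i).
  case: (unliftP c l) => [l' ->|->]; last first.
    have e0 : \forall e \near 0^'+, 0 < e :> R by exact: nbhs_right_gt.
    apply: filterS e0 => e e0; rewrite bar_move; last exact: (latt i).1.
    by rewrite lc add0r mulr_gt0.
  have l0 : 0 < bar (a i) 1 (facet_lift (a i) c y) (lift c l').
    by rewrite facet_lift_bar//; exact: yc.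
  have := near0_pos (bar (a i) 0 (elast R d.+1) (lift c l')) l0.
  by apply: filterS => e; rewrite bar_move//; exact: (latt i).1.
have [e [ae ae']] := filter_ex (@filterI _ _ _ _ _ (up j k yb vk) (up j' k' yb' vk')).
have jj' : j = j'.
  by apply: (dissection_disjoint dis) ae _; rewrite -/p pp'.
apply/val_inj => /=; subst j'; congr (_, _).
apply/eqP/negPn/negP => kk'; case: (unliftP k' k) => [l kl|/eqP]; last by apply/negP.
have := yb' l; rewrite /projected_facet/= -facet_lift_bar// -kl -/p' -pp' pk.
by rewrite ltxx.
Qed.

Lemma dissection_project : lattice_dissection projected_facet (@drop_last R d.+1 @` P).
Proof.
split.
- move=> _ _ t [x Px <-] [y Py <-] t01; exists ((1 - t) *: x + t *: y).
    exact: dissection_convex dis _ _ _ Px Py t01.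
  by rewrite drop_lastD !drop_lastZ.
- exact: projected_cover.
- by move=> b; exact: lattice_position_facet.
- exact: projected_disjoint.
- have [j0 _] := dissection_nonempty dis.
  have : (@drop_last R d.+1 @` P) (drop_last (a j0 ord0)).
    exists (a j0 ord0) => //; apply: (dissection_sub dis (j := j0)) => i.
    rewrite (bar_eq (latt j0).1 (w := fun i => (i == ord0)%:R)) ?ler0n//.
      by rewrite (bigD1 ord0)//= big1 ?addr0// => k /negPf ->.
    rewrite (bigD1 ord0)//= scale1r big1 ?addr0// => k /negPf ->.
    by rewrite scale0r.
  by rewrite projected_cover => -[b _ _]; exists b.
Qed.

End ProjectedDissection.

(** * Measurability and the volume of cubes *)

Section Volume.
Variable R : realType.

Lemma coords_inj d : injective (@coords R d).
Proof.
elim: d => [|d IH] x y; first by move=> _; apply/rowP => -[].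
by move=> [/IH]; exact: row_last_eq.
Qed.

Lemma coords_surj d (p : Rspace d) : exists x : 'rV[R]_d, coords x = p.
Proof.
elim: d p => [[]|d IH [q t]]; first by exists 0.
have [y yq] := IH q.
exists (\row_j oapp (fun k => y 0 k) t (unlift ord_max j)); rewrite /=.
congr (_, _); last by rewrite /last_coord mxE unlift_none.
rewrite -yq; congr coords; apply/rowP => j; rewrite !mxE.
rewrite (_ : widen_ord _ j = lift ord_max j) ?liftK//.
by apply/val_inj; rewrite /= /bump leqNgt ltn_ord.
Qed.

Lemma affine_measurable d (c : R) (b : 'I_d -> R) : exists2 g : Rspace d -> measurableTypeR R,
  measurable_fun [set: Rspace d] g & forall x, g (coords x) = c + \sum_j b j * x 0 j.
Proof.
elim: d b => [|d IH] b.
  by exists (fun=> c) => [|x]; [exact: measurable_cst|rewrite big_ord0 addr0].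
have [g mg gE] := IH (fun j => b (widen_ord (leqnSn d) j)).
exists (fun p : Rspace d.+1 => g p.1 + b ord_max * p.2).
  apply: measurable_realfun.measurable_funD; first exact: (measurableT_comp mg measurable_fst).
  by apply: measurable_realfun.measurable_funM; [exact: measurable_cst|exact: measurable_snd].
move=> x; rewrite /= gE big_ord_recr/= addrA; congr (_ + _ + _).
by apply: eq_bigr => j _; rewrite !mxE.
Qed.

Lemma bar_affine d (a : 'I_d.+1 -> 'rV[R]_d) i : exists c (b : 'I_d -> R), forall x,
  bar a 1 x i = c + \sum_j b j * x 0 j.
Proof.
exists (invmx (hmx a) ord0 i), (fun j => invmx (hmx a) (lift ord0 j) i) => x.
rewrite /bar mxE big_ord_recl vcons0 mul1r; congr (_ + _).
by apply: eq_bigr => j _; rewrite vconsS mulrC.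
Qed.

Lemma measurable_simp d (a : 'I_d.+1 -> 'rV[R]_d) :
  measurable (@coords R d @` simp a : set (Rspace d)).
Proof.
have -> : @coords R d @` simp a = \bigcap_(i in [set: 'I_d.+1]) [set p | exists2 x,
    coords x = p & 0 <= bar a 1 x i].
  apply/seteqP; split=> [_ [x ax <-] i _|p ap]; first by exists x.
  have [x xp] := coords_surj p; exists x => // i.
  by have [y] := ap i I; rewrite -xp => /coords_inj ->.
apply: fin_bigcap_measurable => [|i _]; first exact: finite_finset.
have [c [b bE]] := bar_affine a i; have [g mg gE] := affine_measurable c b.
rewrite (_ : [set p | _] = [set: Rspace d] `&` g @^-1` `[0, +oo[%classic).
  by apply: mg => //; exact: measurable_itv.
apply/seteqP; split=> [p [x <-]|p [_]]; rewrite /= in_itv/= andbT.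
  by rewrite gE bE; split.
by have [x <-] := coords_surj p; rewrite gE -bE; exists x.
Qed.

Lemma measurable_dissection d (J : finType) (a : J -> 'I_d.+2 -> 'rV[R]_d.+1) P :
  lattice_dissection a P -> measurable (@coords R d.+1 @` P : set (Rspace d.+1)).
Proof.
move=> dis; rewrite (dissection_cover dis) image_bigcup.
by apply: fin_bigcup_measurable => [|j _]; [exact: finite_finset|exact: measurable_simp].
Qed.

Definition cube d (c : 'rV[R]_d) (h : R) : set 'rV[R]_d :=
  [set x | forall j, c 0 j < x 0 j <= c 0 j + h].

Lemma cubeS d (c : 'rV[R]_d.+1) h : @coords R d.+1 @` cube c h =
  (@coords R d @` cube (drop_last c) h) `*` `]last_coord c, last_coord c + h]%classic.
Proof.
apply/seteqP; split=> [_ [x xc <-]|[p t] [/= [y yc <-]]].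
  split; last by rewrite /= in_itv/=; exact: xc.
  by exists (drop_last x) => // j; rewrite !mxE.
rewrite in_itv/= => tc; have [x xE] := coords_surj ((coords y, t) : Rspace d.+1).
exists x => // j; case: xE => /coords_inj xy xt.
case: (unliftP ord_max j) => [k|] ->; last by rewrite -/(last_coord x) xt.
have := yc k; rewrite -xy !mxE.
rewrite (_ : widen_ord _ k = lift ord_max k)//.
by apply/val_inj; rewrite /= /bump leqNgt ltn_ord.
Qed.

Lemma measurable_cube d (c : 'rV[R]_d) h :
  measurable (@coords R d @` cube c h : set (Rspace d)).
Proof.
elim: d c => [|d IH] c.
  rewrite (_ : _ @` _ = setT)//; apply/seteqP; split=> // -[] _.
  by exists c => // -[].
by rewrite cubeS; apply: measurableX; [exact: IH|exact: measurable_itv].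
Qed.

Lemma Vol_cube d (c : 'rV[R]_d) h : 0 <= h -> Vol (cube c h) = (h ^+ d)%:E.
Proof.
move=> h0; elim: d c => [|d IH] c.
  rewrite /Vol (_ : _ @` _ = setT) ?expr0; last first.
    by apply/seteqP; split=> // -[] _; exists c => // -[].
  by rewrite /= diracT.
transitivity (Vol (cube (drop_last c) h) *
    lebesgue_measure `]last_coord c, (last_coord c + h)%R]%classic)%E.
  rewrite /Vol cubeS; apply: product_measure1E; [exact: measurable_cube|exact: measurable_itv].
rewrite IH lebesgue_measure_itv/= lte_fin.
have [hp|] := ltP (last_coord c) (last_coord c + h).
  by rewrite -EFinD -EFinM addrAC subrr add0r exprSr.
rewrite gerDl => hN; have -> : h = 0 by apply/eqP; rewrite eq_le hN.
by rewrite mule0 expr0n.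
Qed.

End Volume.

(** * Squeezing the volume between lattice point counts *)

Section Sandwich.
Variable R : realType.

Lemma le0_of_inverse_bound (x c : R) (m0 : nat) :
  (forall m, (m0 < m)%N -> x <= c / m%:R) -> x <= 0.
Proof.
move=> xc; rewrite leNgt; apply/negP => x0.
pose m := maxn m0.+1 (Num.bound `|c / x|).
have m0m : (m0 < m)%N by rewrite leq_max ltnSn.
have mp : 0 < m%:R :> R by rewrite ltr0n (leq_ltn_trans _ m0m).
have := xc m m0m; rewrite ler_pdivlMr// leNgt => /negP; apply.
rewrite mulrC -ltr_pdivrMr//; apply: (le_lt_trans (ler_norm _)).
apply: (lt_le_trans (archi_boundP (normr_ge0 _))).
by rewrite ler_nat /m leq_max leqnn orbT.
Qed.

Lemma bernoulli (x : R) n : 0 <= x <= 1 -> 1 - n%:R * x <= (1 - x) ^+ n.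
Proof.
move=> /andP[x0 x1]; elim: n => [|n IH]; first by rewrite mul0r subr0 expr0.
rewrite exprS -natr1; apply: (@le_trans _ _ ((1 - x) * (1 - n%:R * x))).
  rewrite -subr_ge0 (_ : _ - _ = n%:R * x * x); last by ring.
  by rewrite !mulr_ge0.
by rewrite ler_wpM2l// subr_ge0.
Qed.

(** Divide by m^n and bound the powers of 1 - k/m from below by Bernoulli's
    inequality; the upper bound is first multiplied by (1 - k/m)^n, since (1 - x)(1 +
    x) is at most 1. *)
Lemma homogeneous_squeeze (n k : nat) (v c : R) : 0 <= c -> 0 <= v ->
  (forall m, (k < m)%N -> (m - k)%:R ^+ n * c <= m%:R ^+ n * v <= (m + k)%:R ^+ n * c) ->
  v = c.
Proof.
move=> c0 v0 sq.
have mk m : (k < m)%N -> [/\ 0 < m%:R :> R, 0 <= k%:R / m%:R :> R & k%:R / m%:R <= 1 :> R].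
  move=> km; have mp : 0 < m%:R :> R by rewrite ltr0n (leq_ltn_trans _ km).
  by rewrite mp divr_ge0 ?ler_pdivrMr ?mul1r ?ler_nat ?(ltnW km).
apply/eqP; rewrite eq_le -subr_le0 -[_ <= v]subr_le0; apply/andP; split.
  apply: (@le0_of_inverse_bound _ (n%:R * k%:R * v) k) => m km.
  have [mp x0 x1] := mk m km; have /andP[_ up] := sq m km.
  have b := bernoulli n (x := k%:R / m%:R); rewrite x0 x1 in b.
  have := b isT => {}b.
  have up' : (1 - k%:R / m%:R) ^+ n * v <= c.
    have mE : 1 - k%:R / m%:R = (m%:R - k%:R) / m%:R :> R.
      by rewrite mulrBl divff// gt_eqF.
    rewrite mE expr_div_n mulrAC ler_pdivrMr ?exprn_gt0// [c * _]mulrC.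
    rewrite -(@ler_pM2l _ (m%:R ^+ n)) ?exprn_gt0//.
    apply: (@le_trans _ _ ((m%:R - k%:R) ^+ n * ((m + k)%:R ^+ n * c))).
      rewrite mulrCA ler_wpM2l// exprn_ge0// subr_ge0 ler_nat ltnW//.
    rewrite mulrA -exprMn [X in _ <= X]mulrA -exprMn ler_wpM2r//.
    rewrite lerXn2r ?nnegrE//.
    - by rewrite mulr_ge0// subr_ge0 ler_nat ltnW.
    - have -> : (m%:R - k%:R) * (m + k)%:R = m%:R * m%:R - k%:R ^+ 2 :> R.
        by rewrite natrD; ring.
      by rewrite gerBl sqr_ge0.
  have := le_trans (ler_wpM2r v0 b) up'.
  rewrite mulrBl mul1r (_ : n%:R * (k%:R / m%:R) * v = n%:R * k%:R * v / m%:R).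
    by lra.
  by rewrite !mulrA mulrAC.
apply: (@le0_of_inverse_bound _ (n%:R * k%:R * c) k) => m km.
have [mp x0 x1] := mk m km; have /andP[low _] := sq m km.
have b := bernoulli n (x := k%:R / m%:R); rewrite x0 x1 in b.
have := b isT => {}b.
have low' : (1 - k%:R / m%:R) ^+ n * c <= v.
  have mE : 1 - k%:R / m%:R = (m%:R - k%:R) / m%:R :> R.
    by rewrite mulrBl divff// gt_eqF.
  rewrite mE expr_div_n mulrAC ler_pdivrMr ?exprn_gt0// [v * _]mulrC.
  by rewrite -natrB// ltnW.
have := le_trans (ler_wpM2r c0 b) low'.
rewrite mulrBl mul1r (_ : n%:R * (k%:R / m%:R) * c = n%:R * k%:R * c / m%:R).
  by lra.
by rewrite !mulrA mulrAC.
Qed.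

Lemma cube_disjoint d (z z' : 'rV[R]_d) h x : 0 < h ->
  (forall j, z 0 j \is a Num.int) -> (forall j, z' 0 j \is a Num.int) ->
  cube (h *: z) h x -> cube (h *: z') h x -> z = z'.
Proof.
move=> h0 zZ z'Z xz xz'; apply/rowP => j; have := xz j; have := xz' j; rewrite !mxE.
move=> /andP[l' u'] /andP[l u].
have d1 : z 0 j - z' 0 j < 1 by rewrite -(ltr_pM2l h0); lra.
have d2 : z' 0 j - z 0 j < 1 by rewrite -(ltr_pM2l h0); lra.
apply/eqP; rewrite -subr_eq0; apply: contraT => ne.
have := norm_intr_ge1 (rpredB (zZ j) (z'Z j)) ne.
by rewrite leNgt ltr_norml d1 andbT ltrNl opprB d2.
Qed.

Definition cubes d (Z : seq 'rV[R]_d) (h : R) : set 'rV[R]_d :=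
  [set x | exists2 z, z \in Z & cube (h *: z) h x].

Lemma Vol_cubes d (Z : seq 'rV[R]_d) h : 0 < h -> uniq Z ->
  (forall z, z \in Z -> forall j, z 0 j \is a Num.int) ->
  measurable (@coords R d @` cubes Z h : set (Rspace d)) /\
  Vol (cubes Z h) = ((size Z)%:R * h ^+ d)%:E.
Proof.
move=> h0; elim: Z => [_ _|z Z IH /= /andP[zZ uZ] intZ].
  have -> : cubes (Nil 'rV[R]_d) h = set0 by apply/seteqP; split=> x // [].
  by rewrite /Vol image_set0 measure0 mul0r; split.
have [|mZ VZ] := IH uZ; first by move=> y yZ; apply: intZ; rewrite inE yZ orbT.
have cE : cubes (z :: Z) h = cube (h *: z) h `|` cubes Z h.
  apply/seteqP; split=> [x [y]|x [xz|[y yZ xy]]].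
  - by rewrite inE => /orP[/eqP -> xz|yZ xy]; [left|right; exists y].
  - by exists z; rewrite ?mem_head.
  - by exists y; rewrite ?inE ?yZ ?orbT.
have disj : (@coords R d @` cube (h *: z) h) `&` (@coords R d @` cubes Z h) = set0.
  rewrite -subset0 => _ [[x xz <-] [x' [y yZ xy] /coords_inj xx']].
  rewrite xx' in xy; have zy : z = y.
    by apply: (cube_disjoint h0 _ _ xz xy); apply: intZ; rewrite ?mem_head// inE yZ orbT.
  by move: zZ; rewrite zy yZ.
rewrite cE image_setU; split; first by apply: measurableU => //; exact: measurable_cube.
transitivity (Vol (cube (h *: z) h) + Vol (cubes Z h))%E.
  by rewrite /Vol image_setU; apply: measureU => //; exact: measurable_cube.
by rewrite VZ Vol_cube ?ltW// -EFinD -natr1 mulrDl mul1r addrC.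
Qed.

Lemma dilate_add d (P : set 'rV[R]_d) m1 m2 x y : convex_closed P -> (0 < m1 + m2)%N ->
  dilate m1 P x -> dilate m2 P y -> dilate (m1 + m2) P (x + y).
Proof.
move=> convP m0 [x' Px <-] [y' Py <-].
have mp : 0 < (m1 + m2)%:R :> R by rewrite ltr0n.
exists ((1 - m2%:R / (m1 + m2)%:R) *: x' + (m2%:R / (m1 + m2)%:R) *: y').
  apply: convP => //; rewrite divr_ge0//= ler_pdivrMr// mul1r ler_nat.
  exact: leq_addl.
rewrite scalerDr !scalerA; congr (_ *: _ + _ *: _); last by rewrite mulrC divfK// gt_eqF.
by rewrite mulrBr mulr1 mulrC divfK ?gt_eqF// natrD addrK.
Qed.

Lemma dissection_bounded d (J : finType) (a : J -> 'I_d.+2 -> 'rV[R]_d.+1) P :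
  lattice_dissection a P -> exists B, forall x, P x -> forall j, `|x 0 j| <= B.
Proof.
move=> dis; exists (\sum_j \sum_i \sum_k `|a j i 0 k|) => x Px k.
have [j ax] := dissection_in dis Px; have [aff_a _] := dissection_position dis j.
apply: (@le_trans _ _ (\sum_i `|a j i 0 k|)).
  rewrite -{1}(bar_comb aff_a 1 x) summxE (le_trans (ler_norm_sum _ _ _))//.
  apply: ler_sum => i _; have bi0 : 0 <= bar (a j) 1 x i := ax i.
  have bi1 : bar (a j) 1 x i <= 1.
    rewrite -[leRHS](bar_sum aff_a 1 x) (bigD1 i)//= lerDl.
    by apply: sumr_ge0 => l _; exact: ax.
  by rewrite mxE normrM ger0_norm// ler_piMl.
apply: (@le_trans _ _ (\sum_i \sum_l `|a j i 0 l|)).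
  by apply: ler_sum => i _; rewrite (bigD1 k)//= lerDl sumr_ge0.
rewrite (bigD1 j)//= lerDl; apply: sumr_ge0 => j' _; apply: sumr_ge0 => i _.
by rewrite sumr_ge0.
Qed.

Lemma dilate_bounded d (J : finType) (a : J -> 'I_d.+2 -> 'rV[R]_d.+1) P m :
  lattice_dissection a P ->
  \forall M \near \oo, forall x, dilate m P x -> Zpts x -> x \in box R M d.+1.
Proof.
move=> dis; have [B HB] := dissection_bounded dis.
near=> M => x [y Py yx] xZ; apply/mem_box => j; split; first exact: xZ.
rewrite -yx mxE normrM normr_nat.
apply: (@le_trans _ _ (m%:R * `|B|)).
  by rewrite ler_wpM2l// (le_trans (HB y Py j))// ler_norm.
apply: (le_trans (ltW (archi_boundP _))); first by rewrite mulr_ge0.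
by rewrite ler_nat; near: M; exact: nbhs_infty_ge.
Unshelve. all: by end_near. Qed.

(** The cube is centred at a multiple of the centroid of one of the simplices. *)
Lemma dilate_contains_cube d (J : finType) (a : J -> 'I_d.+2 -> 'rV[R]_d.+1) P :
  lattice_dissection a P -> exists (K : nat) (w : 'rV[R]_d.+1),
    [/\ (0 < K)%N, Zpts w & forall x : 'rV[R]_d.+1, (forall j, `|x 0 j| <= 2) -> dilate K P (w + x)].
Proof.
move=> dis; have [j0 _] := dissection_nonempty dis.
have latt := dissection_position dis j0; have [aff_a _] := latt.
pose n := d.+2; have n0 : n%:R != 0 :> R by rewrite pnatr_eq0.
pose b j := bar (a j0) 0 (delta_mx 0 j).
pose B := \sum_i \sum_j `|b j i|.
have bar0 (x : 'rV[R]_d.+1) i : (forall j, `|x 0 j| <= 2) -> `|bar (a j0) 0 x i| <= 2 * B.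
  move=> x2; have -> : bar (a j0) 0 x i = \sum_j x 0 j * b j i.
    apply: (bar_eq aff_a (w := fun i => \sum_j x 0 j * b j i)).
      rewrite exchange_big/= big1// => j _.
      by rewrite -mulr_sumr bar_sum// mulr0.
    under eq_bigr do rewrite scaler_suml.
    rewrite exchange_big/= [RHS]row_sum_delta; apply: eq_bigr => j _.
    under eq_bigr do rewrite -scalerA.
    by rewrite -scaler_sumr bar_comb.
  rewrite (le_trans (ler_norm_sum _ _ _))// /B (bigD1 i)//= mulrDr.
  apply: ler_wpDr.
    by rewrite mulr_ge0// sumr_ge0// => k _; rewrite sumr_ge0.
  rewrite mulr_sumr; apply: ler_sum => j _.
  by rewrite normrM ler_wpM2r.
have B0 : 0 <= 2 * B.
  by rewrite mulr_ge0// sumr_ge0// => k _; rewrite sumr_ge0.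
pose q := (Num.bound (2 * B)).+1.
have qB : 2 * B <= q%:R.
  by rewrite (le_trans (ltW (archi_boundP B0)))// ler_nat.
(* A multiple of the number of vertices, so that K times the centroid is integral. *)
pose K := (n * q)%N; have K0 : (0 < K)%N by rewrite muln_gt0.
have Kn : K%:R != 0 :> R by rewrite pnatr_eq0 -lt0n.
exists K, (q%:R *: \sum_i a j0 i); split=> //.
  move=> j; rewrite mxE rpredM ?natr_int// summxE rpred_sum// => i _.
  exact: lattice_position_int.
move=> x x2; exists (n%:R^-1 *: (\sum_i a j0 i) + K%:R^-1 *: x).
  apply: (dissection_sub dis (j := j0)) => i; rewrite bar_move//.
  rewrite scaler_sumr (bar_eq aff_a (w := fun=> n%:R^-1))//; last first.
    by rewrite sumr_const card_ord -[LHS]mulr_natl mulfV.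
  have := bar0 x i x2; rewrite ler_norml => /andP[lo _].
  have -> : n%:R^-1 = K%:R^-1 * q%:R :> R.
    by rewrite natrM invfM mulrAC -mulrA mulfV ?mulr1// pnatr_eq0.
  by rewrite -mulrDr mulr_ge0 ?invr_ge0//; lra.
rewrite scalerDr !scalerA mulfV// scale1r; congr (_ *: _ + _).
by rewrite natrM mulrAC mulfV ?mul1r.
Qed.

End Sandwich.

Section DissectionVolume.
Variable R : realType.

Lemma box_count_size M d (A : set 'rV[R]_d) :
  box_count M A = (size [seq x <- box R M d | `[< A x >]])%:R.
Proof.
rewrite /box_count size_filter -sum1_count natr_sum [RHS]big_mkcond.
by apply: eq_bigr => x _; case: asboolP.
Qed.

Lemma dilate_mem d (P : set 'rV[R]_d) m x : (0 < m)%N -> dilate m P (m%:R *: x) -> P x.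
Proof.
move=> m0 [y Py yx]; suff -> : x = y by [].
have mn0 : m%:R != 0 :> R by rewrite pnatr_eq0 -lt0n.
by rewrite -(scale1r x) -(mulVf mn0) -scalerA -yx scalerA mulVf// scale1r.
Qed.

Section Bounds.
Variables (d : nat) (J : finType) (a : J -> 'I_d.+2 -> 'rV[R]_d.+1).
Variable P : set 'rV[R]_d.+1.
Hypothesis dis : lattice_dissection a P.
Variable D : R.
Hypothesis countD : forall m, (0 < m)%N ->
  \forall M \near \oo, box_count M (below (dilate m P)) = m%:R ^+ d.+1 * D.
Variables (K : nat) (w : 'rV[R]_d.+1).
Hypothesis wZ : Zpts w.
Hypothesis cubeP : forall x : 'rV[R]_d.+1, (forall j, `|x 0 j| <= 2) -> dilate K P (w + x).

Variable m : nat.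
Hypothesis Km : (K < m)%N.

Let m_gt0 : (0 < m)%N. Proof. exact: leq_ltn_trans Km. Qed.
Let mp : 0 < m%:R :> R. Proof. by rewrite ltr0n. Qed.
Let hp : 0 < m%:R^-1 :> R. Proof. by rewrite invr_gt0. Qed.
Let mn0 : m%:R != 0 :> R. Proof. by rewrite gt_eqF. Qed.

Let points M k := [seq x <- box R M d.+1 | `[< below (dilate k P) x >]].

Let points_int M k x : x \in points M k -> Zpts x.
Proof. by rewrite mem_filter => /andP[_ /mem_box xB] j; have [] := xB j. Qed.

(** A lattice point of (m - K) P translated by w is the corner of a unit cube
    contained in m P, because K P contains the unit cube at w. *)
Lemma Vol_lower_bound : (((m - K)%:R ^+ d.+1 * D * m%:R^-1 ^+ d.+1)%:E <= Vol P)%E.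
Proof.
have mK0 : (0 < m - K)%N by rewrite subn_gt0.
have [M HM] := filter_ex (countD mK0); rewrite -HM box_count_size -/(points M _).
pose Z := [seq x + w | x <- points M (m - K)].
have uZ : uniq Z.
  by rewrite map_inj_uniq ?filter_uniq ?uniq_box//; exact: addIr.
have intZ z : z \in Z -> forall j, z 0 j \is a Num.int.
  by move=> /mapP[x /points_int xZ ->] j; rewrite mxE rpredD.
have [mZ VZ] := Vol_cubes hp uZ intZ.
rewrite -[size _](size_map (fun x => x + w)) -/Z -VZ.
apply: le_measure; rewrite ?inE//; first exact: measurable_dissection dis.
move=> _ [p [z /mapP[x xpts ->] pz] <-]; exists p => //.
have /andP[/asboolP bx _] : `[< below (dilate (m - K) P) x >] && (x \in box R M d.+1).
  by move: xpts; rewrite mem_filter.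
have Px := below_dissection_sub (dissection_dilate mK0 dis) bx.
apply: (dilate_mem m_gt0); rewrite -(subnK (ltnW Km)).
have -> : (m - K + K)%:R *: p = x + (w + (m%:R *: p - (x + w))).
  by rewrite subnK ?(ltnW Km)//; apply/rowP => j; rewrite !mxE; ring.
apply: dilate_add => //; [exact: dissection_convex dis|by rewrite subnK ?(ltnW Km)|].
apply: cubeP => j; have := pz j; rewrite !mxE => /andP[l u].
have l' : x 0 j + w 0 j < m%:R * p 0 j by rewrite mulrC -ltr_pdivrMr// mulrC.
have u' : m%:R * p 0 j <= x 0 j + w 0 j + 1.
  rewrite -(ler_pM2l hp) mulrA mulVf// mul1r mulrDr mulr1; exact: u.
by rewrite ler_norml; apply/andP; split; lra.
Qed.

(** Every point of m P is in a unit cube with a lattice point z as its corner, and z +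
    w is then a lattice point of (m + K) P with room around it. *)
Lemma Vol_upper_bound : (Vol P <= ((m + K)%:R ^+ d.+1 * D * m%:R^-1 ^+ d.+1)%:E)%E.
Proof.
have mK0 : (0 < m + K)%N by rewrite addn_gt0 m_gt0.
have disK := dissection_dilate mK0 dis.
have [M [HM bd]] := filter_ex (@filterI _ _ _ _ _ (countD mK0) (dilate_bounded (m + K) dis)).
rewrite -HM box_count_size -/(points M _).
pose Z := [seq x - w | x <- points M (m + K)].
have uZ : uniq Z.
  by rewrite map_inj_uniq ?filter_uniq ?uniq_box//; exact: addIr.
have intZ z : z \in Z -> forall j, z 0 j \is a Num.int.
  by move=> /mapP[x /points_int xZ ->] j; rewrite !mxE rpredB.
have [mZ VZ] := Vol_cubes hp uZ intZ.
rewrite -[size _](size_map (fun x => x - w)) -/Z -VZ.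
apply: le_measure; rewrite ?inE//; first exact: measurable_dissection dis.
move=> _ [p Pp <-]; exists p => //.
pose z : 'rV[R]_d.+1 := \row_j (Num.ceil (m%:R * p 0 j) - 1)%:~R.
have zZ : Zpts z by move=> j; rewrite mxE intr_int.
have zp j : z 0 j < m%:R * p 0 j <= z 0 j + 1.
  by rewrite mxE; have := ceil_itv (m%:R * p 0 j); rewrite intrB subrK.
have bz : below (dilate (m + K) P) (z + w).
  have e0 : \forall e \near 0^'+, 0 < e :> R by exact: nbhs_right_gt.
  have e1 : \forall e \near 0^'+, e <= 1 :> R by exact: nbhs_right_le.
  near=> e.
  have -> : z + w - e *: elast R d = m%:R *: p + (w + (z - m%:R *: p - e *: elast R d)).
    by apply/rowP => j; rewrite !mxE; ring.
  apply: dilate_add => //; [exact: dissection_convex dis|by exists p|].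
  apply: cubeP => j; have /andP[l u] := zp j; rewrite !mxE.
  have : 0 < e by near: e.
  have : e <= 1 by near: e.
  rewrite mxE in l u.
  by case: (_ && _); rewrite ?mulr1 ?mulr0 ler_norml => ? ?; apply/andP; split; lra.
exists z.
  apply/mapP; exists (z + w); last by rewrite addrK.
  rewrite /points mem_filter asboolT//=; apply: bd; first exact: below_dissection_sub disK _ bz.
  by move=> j; rewrite mxE rpredD.
move=> j; have /andP[l u] := zp j; rewrite mxE; apply/andP; split.
  by rewrite mulrC ltr_pdivrMr// mulrC.
by rewrite -(ler_pM2l mp) mulrDr mulrA !mulfV// mul1r.
Unshelve. all: by end_near. Qed.

End Bounds.

(** The lower and the upper bound are the same multiple of (m - K)^(d+1) and of (m +
    K)^(d+1), by homogeneity of the counts, and these squeeze the volume. *)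
Theorem Vol_dissection d (J : finType) (a : J -> 'I_d.+2 -> 'rV[R]_d.+1) P (D : R) :
  lattice_dissection a P ->
  (forall m, (0 < m)%N ->
    \forall M \near \oo, box_count M (below (dilate m P)) = m%:R ^+ d.+1 * D) ->
  Vol P = D%:E.
Proof.
move=> dis countD; have [K [w [K0 wZ cubeP]]] := dilate_contains_cube dis.
have low := Vol_lower_bound dis countD wZ cubeP.
have up := Vol_upper_bound dis countD wZ cubeP.
have V0 : (0 <= Vol P)%E by exact: measure_ge0.
have Vfin : Vol P \is a fin_num.
  by rewrite ge0_fin_numE// (le_lt_trans (up K.+1 (ltnSn K)))// ltry.
have D0 : 0 <= D.
  have [M] := filter_ex (countD 1%N isT); rewrite expr1n mul1r => <-.
  by rewrite box_count_size.
rewrite -(fineK Vfin); congr (_%:E).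
apply: (@homogeneous_squeeze _ d.+1 K) => // [|m Km]; first exact: fine_ge0.
have mp : 0 < m%:R ^+ d.+1 :> R by rewrite exprn_gt0// ltr0n (leq_ltn_trans _ Km).
have := low m Km; have := up m Km; rewrite -(fineK Vfin) !lee_fin exprVn.
by rewrite ler_pdivlMr// ler_pdivrMr// [_ * fine _]mulrC => -> ->.
Qed.

End DissectionVolume.

(** * Lattice-face simplices are in lattice position *)

Section LatticeFace.
Variable R : realType.

Lemma bar_vertex d (a : 'I_d.+1 -> 'rV[R]_d) i l : affinely_independent a ->
  bar a 1 (a i) l = (l == i)%:R.
Proof.
move=> aff_a; apply: (bar_eq aff_a (w := fun l => (l == i)%:R)).
  by rewrite (bigD1 i)//= eqxx big1 ?addr0// => k /negPf ->.
by rewrite (bigD1 i)//= eqxx scale1r big1 ?addr0// => k /negPf ->; rewrite scale0r.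
Qed.

Lemma simplex_vertices d (a : 'I_d.+1 -> 'rV[R]_d) i : affinely_independent a ->
  Defs.vertices (Defs.conv (range a)) (a i).
Proof.
move=> aff_a; rewrite -simp_conv//; split; first by move=> l; rewrite bar_vertex.
have face (x : 'rV[R]_d) : simp a x -> (forall l, l != i -> bar a 1 x l = 0) -> x = a i.
  move=> _ x0; have := bar_sum aff_a 1 x; rewrite (bigD1 i)//= big1 // addr0 => xi.
  rewrite -(bar_comb aff_a 1 x) (bigD1 i)//= xi scale1r big1 ?addr0// => l li.
  by rewrite x0// scale0r.
move=> x y t ax ay /andP[t0 t1] E.
have zero l : l != i -> bar a 1 x l = 0 /\ bar a 1 y l = 0.
  move=> li; have : bar a 1 (a i) l = (1 - t) * bar a 1 x l + t * bar a 1 y l.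
    by rewrite {1}E -!barZ// -barD// !mulr1 subrK.
  rewrite bar_vertex// (negPf li) => /esym/eqP.
  have t1' : 0 < 1 - t by rewrite subr_gt0.
  have ax0 := ax l; have ay0 := ay l.
  rewrite paddr_eq0 ?mulr_ge0 ?(ltW t0) ?(ltW t1')// !mulf_eq0.
  by rewrite (gt_eqF t1') (gt_eqF t0)/= => /andP[/eqP -> /eqP ->].
by split; apply: face => // l /zero[].
Qed.

Lemma aff_range d n (p : 'I_n -> 'rV[R]_d) x : Defs.aff (range p) x ->
  exists2 w : 'I_n -> R, \sum_i w i = 1 & x = \sum_i w i *: p i.
Proof.
move=> [m [w [q [w1 qp ->]]]].
have [f fE] : exists f : 'I_m -> 'I_n, forall i, p (f i) = q i.
  by apply: (@fin_all_exists _ (fun=> 'I_n) (fun i j => p j = q i)) => i;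
    have [j _ <-] := qp i; exists j.
exists (fun j => \sum_(i | f i == j) w i).
  rewrite -[RHS]w1 (exchange_big_dep xpredT)//=.
  by apply: eq_bigr => i _; rewrite (big_pred1 (f i))// => k; rewrite eq_sym.
under [RHS]eq_bigr do rewrite scaler_suml.
rewrite (exchange_big_dep xpredT)//=.
by apply: eq_bigr => i _; rewrite (big_pred1 (f i)) ?fE// => k; rewrite eq_sym.
Qed.

Lemma affine_subspace_range d n (p : 'I_n.+1 -> 'rV[R]_d) :
  affinely_independent p -> affine_subspace n (Defs.aff (range p)).
Proof.
move=> aff_p.
have [X XE] : exists X : n.-tuple 'rV[R]_d, forall k : 'I_n,
    X`_k = p (lift ord0 k) - p ord0.
  exists (mktuple (fun k => p (lift ord0 k) - p ord0)) => k.
  by rewrite (nth_mktuple _ 0).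
have freeX : free X.
  apply/freeP => c c0 k.
  have [w wE] : exists w, w = fun i => oapp c (- \sum_k c k) (unlift ord0 i) by eexists.
  have : w (lift ord0 k) = 0.
    apply: aff_p; rewrite big_ord_recl wE unlift_none/=.
      by rewrite [X in _ + X](eq_bigr c) ?addNr// => l _; rewrite liftK.
    rewrite -[RHS]c0 [X in _ + X](eq_bigr (fun l => c l *: p (lift ord0 l))); last first.
      by move=> l _; rewrite liftK.
    under [RHS]eq_bigr do rewrite XE scalerBr.
    by rewrite sumrB -scaler_suml scaleNr addrC.
  by rewrite wE liftK.
exists (p ord0), <<X>>%VS; split.
  by move: freeX; rewrite /free size_tuple => /eqP.
apply/seteqP; split=> [x /aff_range[w w1 ->]|_ [v vX <-]].
  exists (\sum_i w i *: (p i - p ord0)).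
    rewrite /= rpred_sum// => i _; apply: memvZ.
    case: (unliftP ord0 i) => [k|] ->; last by rewrite subrr mem0v.
    by rewrite -XE memv_span// mem_nth// size_tuple.
  under eq_bigr do rewrite scalerBr.
  by rewrite sumrB -scaler_suml w1 scale1r addrC subrK.
rewrite /= in vX; rewrite (coord_span vX).
exists n.+1, (fun i => oapp (fun k => coord X k v) (1 - \sum_k coord X k v) (unlift ord0 i)), p.
split.
- rewrite big_ord_recl unlift_none/= [X in _ + X](eq_bigr (fun k => coord X k v)).
    by rewrite subrK.
  by move=> l _; rewrite liftK.
- by move=> i; exists i.
- rewrite big_ord_recl unlift_none/= scalerBl scale1r -addrA; congr (_ + _).
  under [LHS]eq_bigr do rewrite XE scalerBr.
  rewrite sumrB -scaler_suml addrC; congr (_ + _).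
  by apply: eq_bigr => k _; rewrite liftK.
Qed.

Lemma drop_last_conv d n (p : 'I_n -> 'rV[R]_d.+1) :
  @drop_last R d @` Defs.conv (range p) = Defs.conv (range (fun i => drop_last (p i))).
Proof.
apply/seteqP; split=> [_ [x [m [w [q [w0 w1 qp ->]]]] <-]|y [m [w [q [w0 w1 qp ->]]]]].
  exists m, w, (fun i => drop_last (q i)); split=> //; last exact: drop_last_sum.
  by move=> i; have [j _ <-] := qp i; exists j.
have [f fE] : exists f : 'I_m -> 'I_n, forall i, drop_last (p (f i)) = q i.
  by apply: (@fin_all_exists _ (fun=> 'I_n) (fun i j => drop_last (p j) = q i)) => i;
    have [j _ <-] := qp i; exists j.
exists (\sum_i w i *: p (f i)).
  by exists m, w, (p \o f); split=> // i; exists (f i).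
by rewrite drop_last_sum; apply: eq_bigr => i _; rewrite fE.
Qed.

(** The points of a family are affinely independent as soon as their affine span
    contains all lattice points, there being only d + 1 of them. *)
Lemma affinely_independent_of_lattice d (b : 'I_d.+1 -> 'rV[R]_d) :
  (forall y, Zpts y -> exists2 w : 'I_d.+1 -> R, \sum_i w i = 1 & y = \sum_i w i *: b i) ->
  affinely_independent b.
Proof.
move=> latt.
have rowE y : Zpts y -> exists w : 'rV[R]_d.+1, w *m hmx b = vcons 1 y.
  move=> /latt[w w1 ->]; exists (\row_i w i); rewrite mulmx_hmx.
  by congr vcons; [rewrite -[RHS]w1|]; apply: eq_bigr => i _; rewrite mxE.
have [L LE] : exists L : 'I_d.+1 -> 'rV[R]_d.+1, forall i, L i *m hmx b = delta_mx 0 i.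
  apply: (@fin_all_exists _ (fun=> 'rV[R]_d.+1) (fun i w => w *m hmx b = delta_mx 0 i)) => i.
  have [|w0 w0E] := rowE 0; first by move=> j; rewrite mxE.
  case: (unliftP ord0 i) => [l|] ->; last first.
    exists w0; rewrite w0E; apply/rowP => j; case: (unliftP ord0 j) => [k|] ->.
      by rewrite vconsS !mxE.
    by rewrite vcons0 mxE !eqxx.
  have [|w wE] := rowE (delta_mx 0 l); first by move=> j; rewrite mxE natr_int.
  exists (w - w0); rewrite mulmxBl wE w0E; apply/rowP => j.
  case: (unliftP ord0 j) => [k|] ->.
    by rewrite [LHS]mxE vconsS [X in _ + X]mxE vconsS !mxE subr0 (inj_eq (@lift_inj _ _)).
  by rewrite [LHS]mxE vcons0 [X in _ + X]mxE vcons0 subrr mxE eqxx.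
have /mulmx1_unit[_ ub] : (\matrix_i L i) *m hmx b = 1%:M.
  by apply/row_matrixP => i; rewrite row_mul rowK LE row1.
move=> w w0 wb i.
have wm : (\row_i w i) *m hmx b = 0.
  rewrite mulmx_hmx; apply/rowP => j; rewrite mxE [RHS]mxE.
  case: (unliftP ord0 j) => [k|] _ /=.
    have := congr1 (fun M : 'rV[R]_d => M 0 k) wb; rewrite !summxE [in RHS]mxE => wk.
    by rewrite -[RHS]wk; apply: eq_bigr => l _; rewrite !mxE.
  by rewrite -[RHS]w0; apply: eq_bigr => l _; rewrite mxE.
have : (\row_i w i) = 0 :> 'rV[R]_d.+1.
  by rewrite -[LHS](mulmxK ub) wm mul0mx.
by move=> /rowP/(_ i); rewrite !mxE.
Qed.

End LatticeFace.

Section LatticeFacePosition.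
Variable R : realType.

Lemma widen_lift d (k : 'I_d) : widen_ord (leqnSn d) k = lift ord_max k.
Proof. by apply/val_inj; rewrite /= /bump leqNgt ltn_ord. Qed.

Lemma sum_below_max d (f : 'I_d.+1 -> R) :
  \sum_(l < d.+1 | (l < @ord_max d)%N) f l = \sum_(l < d) f (lift ord_max l).
Proof.
rewrite big_mkcond big_ord_recr/= ltnn addr0.
by apply: eq_bigr => l _; rewrite ltn_ord widen_lift.
Qed.

Lemma sum_below_lift d (k : 'I_d) (f : 'I_d.+1 -> R) :
  \sum_(l < d.+1 | (l < lift ord_max k)%N) f l =
  \sum_(l < d | (l < k)%N) f (lift ord_max l).
Proof.
rewrite -(widen_lift k) big_mkcond big_ord_recr/= ltnNge (ltnW (ltn_ord k))/= addr0.
by rewrite [RHS]big_mkcond; apply: eq_bigr => l _; rewrite widen_lift.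
Qed.

Section Step.
Variables (d : nat) (a : 'I_d.+2 -> 'rV[R]_d.+1) (j : 'I_d.+2).
Hypothesis aff_a : affinely_independent a.
Let aj k := a (lift j k).
Hypothesis liftZ : @drop_last R d @` Lpts (Defs.aff (range aj)) = @Zpts R d.

Lemma lattice_lift y : Zpts y -> exists w : 'I_d.+1 -> R,
  [/\ \sum_k w k = 1, y = \sum_k w k *: facet a j k &
      \sum_k w k * last_coord (aj k) \is a Num.int].
Proof.
rewrite -liftZ => -[x [/aff_range[w w1 xE] xZ] <-]; exists w; split => //.
  by rewrite xE drop_last_sum.
have := xZ ord_max; rewrite xE summxE.
by under eq_bigr do rewrite mxE.
Qed.

Lemma facet_independent : affinely_independent (facet a j).
Proof.
apply: affinely_independent_of_lattice => y /lattice_lift[w [w1 yE _]].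
by exists w.
Qed.

(** On the hyperplane of a facet the last coordinate is an affine function of the
    others. It takes integer values at lattice points, each of which lifts to a
    lattice point of the hyperplane; so its coefficients are integers. *)
Lemma facet_last_integral : exists (c0 : R) (c : 'I_d -> R),
  [/\ c0 \is a Num.int, forall l, c l \is a Num.int &
      forall k, last_coord (aj k) = c0 + \sum_l c l * facet a j k 0 l].
Proof.
have aff_b := facet_independent.
pose g t y := \sum_k bar (facet a j) t y k * last_coord (aj k).
have gZ y : Zpts y -> g 1 y \is a Num.int.
  move=> /lattice_lift[w [w1 yE wZ]].
  by rewrite /g; under eq_bigr do rewrite (bar_eq aff_b w1 (esym yE)).
have gD s t x y : g (s + t) (x + y) = g s x + g t y.
  by rewrite /g -big_split/=; apply: eq_bigr => k _; rewrite barD// mulrDl.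
have gZr t c x : g (c * t) (c *: x) = c * g t x.
  by rewrite /g mulr_sumr; apply: eq_bigr => k _; rewrite barZ// mulrA.
have g0 : g 1 0 \is a Num.int by apply: gZ => l; rewrite mxE.
exists (g 1 0), (fun l => g 0 (delta_mx 0 l)); split => // [l|k].
  have := gZ (0 + delta_mx 0 l).
  rewrite -[X in g X _](addr0 1) gD => h.
  rewrite -[g 0 _](addKr (g 1 0)) addrC rpredB// h// => i.
  by rewrite !mxE add0r natr_int.
have gsum n (u : 'I_n -> R) (v : 'I_n -> 'rV[R]_d) :
    g 0 (\sum_l u l *: v l) = \sum_l u l * g 0 (v l).
  elim: n u v => [|n IH] u v.
    rewrite !big_ord0 -[X in g X _](mul0r 0) -[X in g _ X](scale0r 0) gZr.
    by rewrite mul0r.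
  rewrite !big_ord_recr/= -IH -[X in g X _](addr0 0) gD; congr (_ + _).
  by rewrite -[in LHS](mulr0 (u ord_max)) gZr.
have -> : last_coord (aj k) = g 1 (facet a j k).
  rewrite /g (bigD1 k)//= bar_vertex// eqxx mul1r big1 ?addr0// => l lk.
  by rewrite bar_vertex// (negPf lk) mul0r.
rewrite -[facet a j k in LHS]add0r -[X in g X _](addr0 1) gD; congr (_ + _).
rewrite [X in g 0 X]row_sum_delta gsum.
by apply: eq_bigr => l _; rewrite mulrC.
Qed.

End Step.

(** The facet conditions only speak of vertex sets of full size; smaller vertex sets
    are reached through the recursion of the definition. *)
Theorem lattice_face_position d (a : 'I_d.+2 -> 'rV[R]_d.+1) :
  affinely_independent a -> lattice_face (Defs.conv (range a)) -> lattice_position a.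
Proof.
elim: d a => [|d IH] a aff_a lfa; split => // k S Sk.
  have aZ i : a i 0 k \is a Num.int by case: lfa => _; apply; exact: simplex_vertices.
  have no_below (c : 'I_1 -> R) i : \sum_(j < 1 | (j < k)%N) c j * a i 0 j = 0.
    by rewrite big1// => j; rewrite (ord1 k) ltn0.
  have [S0|[i iS]] := set_0Vmem S.
    by exists 0, (fun=> 0); split => // i; rewrite S0 inE.
  exists (a i 0 k), (fun=> 0); split => // l lS; rewrite no_below addr0.
  have /card_le1_eqP Seq : (#|S| <= 1)%N by rewrite (leq_trans Sk)// (ord1 k).
  by rewrite (Seq l i lS iS).
have [j jS] : exists j, j \notin S.
  apply/existsP; rewrite -negb_forall; apply/negP => /forallP allS.
  have : (d.+3 <= #|S|)%N.
    by rewrite -[leqLHS](card_ord d.+3) subset_leq_card//; apply/fintype.subsetP => i _.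
  by rewrite leqNgt (leq_ltn_trans Sk)// ltnS ltn_ord.
pose aj l := a (lift j l).
have aff_aj : affinely_independent aj.
  move=> w w0 wa l.
  have : oapp w 0 (unlift j (lift j l)) = 0.
    apply: (aff_a (fun i => oapp w 0 (unlift j i))).
      rewrite (bigD1_ord j)//= unlift_none add0r -[RHS]w0.
      by apply: eq_bigr => i _; rewrite liftK.
    by rewrite sum_lift_extend.
  by rewrite liftK.
case: lfa => _ /(_ (range aj)) [||lf_proj lift_int].
- by move=> _ [l _ <-]; exact: simplex_vertices.
- exact: affine_subspace_range.
have latt_facet : lattice_position (facet a j).
  apply: IH; first exact: (facet_independent lift_int).
  by rewrite drop_last_conv in lf_proj.
case: (unliftP ord_max k) Sk => [k'|] -> Sk.
  pose S' := finset (fun l => lift j l \in S).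
  have [|c0 [c [c0Z cZ cE]]] := latt_facet.2 k' S'.
    rewrite -widen_lift in Sk; apply: leq_trans Sk; rewrite -(card_lift_imset j).
    by apply/subset_leq_card/fintype.subsetP => _ /imsetP[l + ->]; rewrite inE.
  exists c0, (fun l => oapp c 0 (unlift ord_max l)); split=> //.
    by move=> l; case: unliftP => [m _|_] /=; rewrite ?cZ ?rpred0.
  move=> i; case: (unliftP j i) => [l ->|->]; last by rewrite (negPf jS).
  move=> lS; rewrite sum_below_lift -widen_lift.
  have := cE l; rewrite inE => /(_ lS); rewrite mxE => ->; congr (_ + _).
  by apply: eq_bigr => m _; rewrite mxE liftK/= widen_lift.
have [c0 [c [c0Z cZ cE]]] := facet_last_integral lift_int.
exists c0, (fun l => oapp c 0 (unlift ord_max l)); split=> //.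
  by move=> l; case: unliftP => [m _|_] /=; rewrite ?cZ ?rpred0.
move=> i; case: (unliftP j i) => [l ->|->]; last by rewrite (negPf jS).
move=> lS; rewrite sum_below_max -/(last_coord _) cE; congr (_ + _).
by apply: eq_bigr => m _; rewrite mxE liftK/= widen_lift.
Qed.

End LatticeFacePosition.

(** * Ehrhart counts of dissected polytopes *)

Section Ehrhart.
Variable R : realType.

Lemma counting_seq (T : choiceType) (s : seq T) :
  uniq s -> counting [set` s] = (size s)%:R%:E :> \bar R.
Proof.
move=> us; rewrite /counting asboolT; last exact: finite_seq.
congr (_%:R%:E); apply/perm_size/uniq_perm => //.
move=> x; rewrite (in_fset_set (finite_seq s) x).
by apply/idP/idP; rewrite inE.
Qed.

Definition lattice_bounded d (A : set 'rV[R]_d) : Prop :=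
  \forall M \near \oo, forall x, A x -> Zpts x -> x \in box R M d.

Lemma lattice_bounded_sub d (A B : set 'rV[R]_d) :
  A `<=` B -> lattice_bounded B -> lattice_bounded A.
Proof.
by move=> AB; rewrite /lattice_bounded; apply: filterS => M BM x /AB; exact: BM.
Qed.

Lemma Lpts_seq d (A : set 'rV[R]_d) : lattice_bounded A ->
  \forall M \near \oo, Lpts A = [set` [seq x <- box R M d | `[< A x >]]].
Proof.
rewrite /lattice_bounded; apply: filterS => M AM; apply/seteqP; split=> x /=; rewrite mem_filter.
  by move=> [Ax Zx]; rewrite AM// andbT; apply/asboolP.
by move=> /andP[/asboolP Ax /mem_box xB]; split => // j; have [] := xB j.
Qed.

Lemma counting_box d (A : set 'rV[R]_d) : lattice_bounded A ->
  \forall M \near \oo, counting (Lpts A) = (box_count M A)%:E.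
Proof.
move=> /Lpts_seq; apply: filterS => M ->.
by rewrite counting_seq ?filter_uniq ?uniq_box// box_count_size.
Qed.

Lemma dilate1 d (A : set 'rV[R]_d) : dilate 1 A = A.
Proof.
apply/seteqP; split=> [_ [x Ax <-]|x Ax]; first by rewrite scale1r.
by exists x => //; rewrite scale1r.
Qed.

Lemma dilate_dilate d (A : set 'rV[R]_d) m k : dilate k (dilate m A) = dilate (k * m) A.
Proof.
apply/seteqP; split=> [_ [_ [x Ax <-] <-]|_ [x Ax <-]].
  by exists x => //; rewrite scalerA natrM.
by exists (m%:R *: x); [exists x|rewrite scalerA natrM].
Qed.

Lemma drop_last_dilate d (A : set 'rV[R]_d.+1) m :
  @drop_last R d @` dilate m A = dilate m (@drop_last R d @` A).
Proof.
apply/seteqP; split=> [_ [_ [x Ax <-] <-]|_ [_ [x Ax <-] <-]].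
  by exists (drop_last x); [exists x|rewrite drop_lastZ].
by exists (m%:R *: x); [exists x|rewrite drop_lastZ].
Qed.

Section Dissected.
Variables (d : nat) (J : finType) (a : J -> 'I_d.+2 -> 'rV[R]_d.+1).
Variable P : set 'rV[R]_d.+1.
Hypothesis dis : lattice_dissection a P.

Lemma dissection_lattice_bounded : lattice_bounded P.
Proof. by have := dilate_bounded 1 dis; rewrite dilate1. Qed.

Lemma counting_Omega : counting (Lpts (Omega P)) = Vol P.
Proof.
have [D HD] := dissection_count dis.
have bO : lattice_bounded (below P).
  exact: lattice_bounded_sub (below_dissection_sub dis) dissection_lattice_bounded.
rewrite (Vol_dissection dis HD) (Omega_dissection dis).
have [M [-> +]] := filter_ex (@filterI _ _ _ _ _ (counting_box bO) (HD 1%N isT)).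
by rewrite dilate1 expr1n mul1r => ->.
Qed.

Lemma Vol_dilate m : (0 < m)%N -> Vol (dilate m P) = (Vol P * (m%:R ^+ d.+1)%:E)%E.
Proof.
move=> m0; have [D HD] := dissection_count dis.
rewrite (Vol_dissection dis HD).
rewrite (Vol_dissection (dissection_dilate m0 dis) (D := m%:R ^+ d.+1 * D)).
  by rewrite -EFinM mulrC.
move=> k k0; rewrite dilate_dilate.
have := HD (k * m)%N; rewrite muln_gt0 k0 m0 => /(_ isT).
by apply: filterS => M ->; rewrite natrM exprMn mulrA.
Qed.

Lemma NB_sub : NB P `<=` P.
Proof. by move=> x [y _ [[_ Px] _]]. Qed.

(** The lowest point over a lattice point of the projection is a lattice point, since
    it lies on a hyperplane that is the graph of an integral affine function. *)
Lemma Lpts_projection : Lpts (@drop_last R d @` P) = @drop_last R d @` Lpts (NB P).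
Proof.
apply/seteqP; split=> [y [[z Pz zy] yZ]|_ [x [Nx xZ] <-]]; last first.
  split; first by exists x => //; exact: NB_sub.
  by move=> j; rewrite mxE.
have [n [j [k [low _ _ nk]]]] := exists_lowest dis Pz.
have [[/= nz Pn] _] := low; rewrite zy in nz.
exists n => //; split; first by exists y; [exists z|rewrite -zy].
have latt := dissection_position dis j; have [aff_a _] := latt.
move=> i; case: (unliftP ord_max i) => [l|] ->.
  by have := yZ l; rewrite -nz mxE widen_lift.
have [|c0 [c [c0Z cZ]]] := @lattice_position_sum _ _ _ ord_max (bar (a j) 1 n) latt.
  apply: (@leq_trans #|[set~ k]%SET|); last by rewrite cardsC1 card_ord.
  apply/subset_leq_card/fintype.subsetP => l; rewrite !inE.
  by apply: contraNneq => ->; rewrite nk.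
rewrite bar_sum// bar_comb// mulr1 => ->; rewrite rpredD// sum_below_max rpred_sum// => l _.
by rewrite rpredM//; have := yZ l; rewrite -nz mxE widen_lift.
Qed.

Lemma NB_inj x x' : NB P x -> NB P x' -> drop_last x = drop_last x' -> x = x'.
Proof.
move=> [y _ [[/= xy Px] lx]] [y' _ [[/= xy' Px'] lx']] xx'.
apply: row_last_eq => //; apply/eqP; rewrite eq_le lx/= ?lx'//; split => //=.
  by rewrite -xy' -xx'.
by rewrite -xx'.
Qed.

(** The projection is injective on the negative boundary, the complement of the
    nonnegative part. *)
Lemma counting_decompose :
  counting (Lpts P) = (Vol P + counting (Lpts (@drop_last R d @` P)))%E.
Proof.
have bP := dissection_lattice_bounded.
have bO : lattice_bounded (Omega P).
  by apply: lattice_bounded_sub bP => x [].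
have bN : lattice_bounded (NB P).
  exact: lattice_bounded_sub NB_sub bP.
have [M [cP [cO cN]]] := filter_ex (@filterI _ _ _ _ _ (counting_box bP)
  (@filterI _ _ _ _ _ (counting_box bO) (Lpts_seq bN))).
rewrite -counting_Omega cO cP Lpts_projection cN.
set s := [seq x <- _ | _].
rewrite (_ : @drop_last R d @` [set` s] = [set` map (@drop_last R d) s]); last first.
  apply/seteqP; split=> [_ [x /= xs <-]|y /= /mapP[x xs ->]]; first exact: map_f.
  by exists x.
rewrite counting_seq.
  rewrite size_map -EFinD -box_count_size; congr (_%:E); rewrite /box_count -big_split/=.
  apply: eq_bigr => x _; have [Px|nPx] := pselect (P x).
    rewrite [`[< P x >]]asboolT//; have [Nx|nNx] := pselect (NB P x).
      by rewrite [`[< NB P x >]]asboolT// asboolF ?add0r// => -[].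
    by rewrite [`[< NB P x >]]asboolF// addr0 asboolT.
  rewrite [`[< P x >]]asboolF// [`[< NB P x >]]asboolF ?addr0; last by move=> /NB_sub.
  by rewrite asboolF// => -[].
rewrite map_inj_in_uniq ?filter_uniq ?uniq_box// => x x'.
by rewrite !mem_filter => /andP[/asboolP Nx _] /andP[/asboolP Nx' _]; exact: NB_inj.
Qed.

End Dissected.

Lemma ehrhart_recursion d (J : finType) (a : J -> 'I_d.+2 -> 'rV[R]_d.+1) P m :
  lattice_dissection a P -> (0 < m)%N ->
  ehrhart P m = (Vol (dilate m P) + ehrhart (@drop_last R d @` P) m)%E.
Proof.
move=> dis m0; rewrite /ehrhart (counting_decompose (dissection_dilate m0 dis)).
by rewrite drop_last_dilate.
Qed.

Lemma proj_to_drop_last k d (h : (k <= d.+1)%N) (h' : (k <= d)%N) (x : 'rV[R]_d.+1) :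
  proj_to h x = proj_to h' (drop_last x).
Proof. by apply/rowP => i; rewrite !mxE; congr (x 0 _); apply/val_inj. Qed.

Lemma proj_to_id d (h : (d <= d)%N) (A : set 'rV[R]_d) : proj_to h @` A = A.
Proof.
have pid x : proj_to h x = x.
  by apply/rowP => i; rewrite !mxE; congr (x 0 _); apply/val_inj.
by apply/seteqP; split=> [_ [x Ax <-]|x Ax]; [rewrite pid|exists x].
Qed.

Lemma rV0_nonempty (A : set 'rV[R]_0) : A !=set0 -> A = [set 0].
Proof.
have all0 (x : 'rV[R]_0) : x = 0 by apply/rowP => -[].
move=> [y Ay]; apply/seteqP; split=> x; first by rewrite (all0 x).
by rewrite (all0 x) -(all0 y).
Qed.

Lemma ehrhart_rV0 (A : set 'rV[R]_0) m : A !=set0 -> ehrhart A m = 1%E.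
Proof.
move=> [y Ay]; rewrite /ehrhart (_ : Lpts _ = [set` [:: 0]]); first by rewrite counting_seq.
rewrite (rV0_nonempty (A := Lpts _)).
  by apply/seteqP; split=> x /=; rewrite inE => /eqP.
by exists (m%:R *: y); split; [exists y|case].
Qed.

Lemma Vol_rV0 (A : set 'rV[R]_0) : A !=set0 -> Vol A = 1%E.
Proof.
by move=> /rV0_nonempty ->; rewrite /Vol image_set1 /= diracE mem_set.
Qed.

Lemma ehrhart_expansion d (J : finType) (a : J -> 'I_d.+2 -> 'rV[R]_d.+1) P m :
  lattice_dissection a P -> (0 < m)%N ->
  ehrhart P m =
    (\sum_(k < d.+2) Vol (proj_to (leq_ord k) @` P) * (m%:R ^+ k)%:E)%E.
Proof.
move=> + m0; elim: d J a P => [|d IH] J a P dis.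
  have P0 : P !=set0.
    have [j _] := dissection_nonempty dis; exists (a j ord0).
    apply: (dissection_sub dis (j := j)) => i.
    by rewrite bar_vertex//; exact: (dissection_position dis j).1.
  rewrite (ehrhart_recursion dis m0) ehrhart_rV0; last exact: image_nonempty.
  rewrite big_ord_recr big_ord1/= proj_to_id Vol_rV0; last exact: image_nonempty.
  by rewrite (Vol_dilate dis m0) expr0 mule1 addeC.
rewrite (ehrhart_recursion dis m0) (IH _ _ _ (dissection_project dis)).
rewrite [RHS]big_ord_recr/= proj_to_id (Vol_dilate dis m0) addeC; congr (_ + _)%E.
apply: eq_bigr => k _; congr (Vol _ * _)%E; rewrite image_comp.
apply: eq_imagel => x _; exact/esym/proj_to_drop_last.
Qed.

End Ehrhart.

(** * The triangulated polytope *)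

Section Triangulation.
Variable R : realType.

Lemma conv_convex d (A : set 'rV[R]_d) : convex_closed (Defs.conv A).
Proof.
move=> _ _ t [m [w [p [w0 w1 Ap ->]]]] [n [v [q [v0 v1 Aq ->]]]] /andP[t0 t1].
pose u (i : 'I_(m + n)) := match fintype.split i with
  inl j => (1 - t) * w j | inr k => t * v k end.
pose r (i : 'I_(m + n)) := match fintype.split i with inl j => p j | inr k => q k end.
have ul j : u (lshift n j) = (1 - t) * w j by rewrite /u -[lshift n j]/(unsplit (inl j)) unsplitK.
have ur k : u (rshift m k) = t * v k by rewrite /u -[rshift m k]/(unsplit (inr k)) unsplitK.
have rl j : r (lshift n j) = p j by rewrite /r -[lshift n j]/(unsplit (inl j)) unsplitK.
have rr k : r (rshift m k) = q k by rewrite /r -[rshift m k]/(unsplit (inr k)) unsplitK.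
exists (m + n)%N, u, r; split.
- by move=> i; rewrite /u; case: fintype.split => j; rewrite mulr_ge0// subr_ge0.
- rewrite big_split_ord/= (eq_bigr _ (fun j _ => ul j)) (eq_bigr _ (fun k _ => ur k)).
  by rewrite -!mulr_sumr w1 v1 !mulr1 subrK.
- by move=> i; rewrite /r; case: fintype.split.
- rewrite big_split_ord/= !scaler_sumr; congr (_ + _); apply: eq_bigr => j _.
    by rewrite ul rl scalerA.
  by rewrite ur rr scalerA.
Qed.

Lemma osimp_interior d (a : 'I_d.+2 -> 'rV[R]_d.+1) : osimp a `<=` interior (simp a).
Proof.
move=> x ax; rewrite /interior/=.
suff : \forall y \near x, forall i, 0 < bar a 1 y i.
  by apply: filterS => y ay i; exact: ltW.
apply: (@filter_forall _ _ (fun i y => 0 < bar a 1 y i) (nbhs x)) => i; have [c [b bE]] := bar_affine a i.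
have cont : {for x, continuous (fun y : 'rV[R]_d.+1 => bar a 1 y i)}.
  pose F j (y : 'rV[R]_d.+1) := b j * y 0 j.
  have -> : (fun y : 'rV[R]_d.+1 => bar a 1 y i) = (fun=> c) + \sum_j F j.
    by apply/funext => y; rewrite bE fctE fct_sumE.
  apply: continuousD; first exact: cst_continuous.
  elim/big_ind: _ => [|f g fx gx|j _]; first exact: cst_continuous.
    exact: continuousD.
  by apply: continuousM; [exact: cst_continuous|exact: coord_continuous].
have := cont; move=> /(_ [set r | 0 < r]); apply.
exact: lt_nbhsr.
Qed.

(** A point in the interior of a simplex is not in its boundary, so the interiors are
    disjoint. *)
Lemma triangulation_dissection d l (P : set 'rV[R]_d.+1) (T : 'I_l -> set 'rV[R]_d.+1) :
  polytope P -> decomposition P T -> (forall i, lattice_face_simplex (T i)) ->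
  exists a : 'I_l -> 'I_d.+2 -> 'rV[R]_d.+1,
    (forall i, T i = simp (a i)) /\ lattice_dissection a P.
Proof.
move=> [[V _ PV] [p0 [W [_ affP]]]] [cover disj] lfT.
have [a aP] : exists a : 'I_l -> 'I_d.+2 -> 'rV[R]_d.+1, forall i,
    affinely_independent (a i) /\ T i = Defs.conv (range (a i)).
  by apply: (@fin_all_exists _ (fun=> 'I_d.+2 -> 'rV[R]_d.+1) (fun i a =>
    affinely_independent a /\ T i = Defs.conv (range a))) => i; case: (lfT i).
have TE i : T i = simp (a i) by rewrite (aP i).2 simp_conv//; case: (aP i).
exists a; split => //; split.
- by rewrite PV; exact: conv_convex.
- by rewrite cover; apply: eq_bigcupr => i _.
- move=> i; apply: lattice_face_position; first by case: (aP i).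
  by rewrite -(aP i).2; case: (lfT i).
- move=> i j x ai aj; apply: contrapT => /eqP ij.
  have [] := disj i j ij x; first by rewrite !TE; split; exact: osimp_simp.
  by rewrite !TE => -[_ +] _; apply; exact: osimp_interior.
- have : Defs.aff P p0 by rewrite affP; exists 0; rewrite ?addr0//= mem0v.
  move=> [[|m] [w [q [w1 Pq _]]]].
    by move: w1; rewrite big_ord0 => /esym/eqP; rewrite oner_eq0.
  by have := Pq ord0; rewrite cover => -[i _ _]; exists i.
Qed.

End Triangulation.

Theorem proposition4p2 (R : realType) (n l : nat)
    (P : set 'rV[R]_n.+1) (T : 'I_l -> set 'rV[R]_n.+1)
    (polyP : polytope P)
    (decP : decomposition P T)
    (lfsT : forall i, lattice_face_simplex (T i)) :
  [/\ (\1_(Omega P) : 'rV[R]_n.+1 -> int) = \sum_(i < l) \1_(Omega (T i)),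
      counting (Lpts (Omega P)) = Vol P
    & forall m : nat, (0 < m)%N ->
        ehrhart P m =
          (Vol (dilate m P) + ehrhart (@drop_last R n @` P) m)%E /\
        ehrhart P m =
          (\sum_(k < n.+2)
             Vol (proj_to (leq_ord k) @` P) * (m%:R ^+ k)%:E)%E].
Proof.
have [a [TE dis]] := triangulation_dissection polyP decP lfsT.
split.
- apply/funext => x; rewrite fct_sumE.
  have indic (A : set 'rV[R]_n.+1) : \1_A x = `[< A x >]%:R :> int.
    by rewrite indicE; congr (_%:R); congr nat_of_bool; apply/idP/asboolP; rewrite inE.
  rewrite indic (Omega_dissection dis) (below_indicator dis); apply: eq_bigr => i _.
  by rewrite indic TE Omega_simp//; exact: dissection_position dis i.
- exact: counting_Omega dis.
- move=> m m0; split; first exact: ehrhart_recursion dis m0.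
  exact: ehrhart_expansion dis m0.
Qed.
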